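(* Let $\varphi\in C(\overline{\mathbb D})\cap AQ(\mathbb D)$ satisfy $\operatorname{Re}\varphi(z)\ge|\operatorname{Im}\varphi(z)|^2$ for all $z\in\mathbb D$. Then the Toeplitz operator $T_\varphi$ is invertible on $A^2$ if and only if it is a Fredholm operator.
   Context: $\mathbb D$ is the open unit disc, $dA$ normalized area measure, $A^2$ the Bergman space of analytic functions in $L^2(\mathbb D,dA)$, $P$ the orthogonal projection $L^2\to A^2$, and $T_\varphi f=P(\varphi f)$ on $A^2$. $AQ(\mathbb D)$ denotes the closed subalgebra of $L^\infty(\mathbb D)$ consisting of those $\psi$ for which the Hankel operator $H_\psi=(I-P)M_\psi:A^2\to L^2$ is compact, where $M_\psi f=\psi f$. *)

(* Defs.v *)
(* MathComp-Analysis over an abstract R : realType,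
   complex numbers are mathcomp-real-closed's  R[i] = complex R.
   Points of the plane are pairs p : R * R  (p <-> p.1 + i p.2);
   functions on the disc are maps  R * R -> R[i]  (only values on the open
   unit disc matter). *)
From HB Require Import structures.
From mathcomp Require Import all_boot all_order all_algebra.
From mathcomp Require Import all_classical all_reals all_analysis.
From mathcomp.real_closed Require Import complex.
Import Order.TTheory GRing.Theory Num.Theory.
Import numFieldNormedType.Exports.
Local Open Scope classical_set_scope.
Local Open Scope ring_scope.

Set Implicit Arguments.
Unset Strict Implicit.
Unset Printing Implicit Defensive.

Section Bergman.
Variable R : realType.

Definition fn := R * R -> R[i].

Definition zc (p : R * R) : R[i] := (p.1 +i* p.2)%C.

Definition ReC (z : R[i]) : R := complex.Re z.
Definition ImC (z : R[i]) : R := complex.Im z.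

Definition cmod (z : R[i]) : R := Num.sqrt (ReC z ^+ 2 + ImC z ^+ 2).

Definition cconj (z : R[i]) : R[i] := conjc z.

Definition area := (@lebesgue_measure R \x @lebesgue_measure R)%E.

Definition Dp : set (R * R) := [set p | p.1 ^+ 2 + p.2 ^+ 2 < 1].
Definition cDp : set (R * R) := [set p | p.1 ^+ 2 + p.2 ^+ 2 <= 1].

Definition eqD (f g : fn) := forall p, Dp p -> f p = g p.

Definition measC (f : fn) :=
  measurable_fun Dp (fun p => ReC (f p)) /\ measurable_fun Dp (fun p => ImC (f p)).

Definition L2 (f : fn) :=
  measC f /\ (\int[area]_(p in Dp) ((cmod (f p)) ^+ 2)%:E < +oo)%E.

(* squared norm in L^2(D, dA), dA = dx dy / pi normalized area measure *)
Definition sqnorm (f : fn) : R :=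
  pi^-1 * Rintegral area Dp (fun p => (cmod (f p)) ^+ 2).

Definition ip (f g : fn) : R[i] :=
  ((pi^-1 * Rintegral area Dp (fun p => ReC (f p * cconj (g p))))
    +i* (pi^-1 * Rintegral area Dp (fun p => ImC (f p * cconj (g p)))))%C.

(* analytic on D: given on D by a power series centred at 0
   (equivalent to holomorphy on D) *)
Definition analyticD (f : fn) :=
  exists a : nat -> R[i], forall p, Dp p ->
    (fun N : nat => cmod (f p - \sum_(n < N) a n * zc p ^+ n)) @ \oo --> (0 : R).

Definition A2 (f : fn) := L2 f /\ analyticD f.

Definition orthA2 (u : fn) := forall h, A2 h -> ip u h = 0.

(* orthogonal projection P : L^2 -> A^2 (Pu is the element g of A^2 with
   u - g orthogonal to A^2; it is unique on D) *)
Definition Pproj (u : fn) : fn :=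
  xget (fun _ => 0) [set g | A2 g /\ orthA2 (fun p => u p - g p)].

Definition Mul (psi f : fn) : fn := fun p => psi p * f p.

Definition Toeplitz (phi : fn) (f : fn) : fn := Pproj (Mul phi f).

Definition Hankel (psi : fn) (f : fn) : fn :=
  fun p => Mul psi f p - Pproj (Mul psi f) p.

Definition compact_op (T : fn -> fn) :=
  forall u : nat -> fn, (forall n, A2 (u n)) ->
    (exists M : R, forall n, sqnorm (u n) <= M) ->
    exists sigma : nat -> nat, {homo sigma : m n / (m < n)%N} /\
      exists g, L2 g /\
        (fun n => sqnorm (fun p => T (u (sigma n)) p - g p)) @ \oo --> (0 : R).

Definition Linfty (psi : fn) :=
  measC psi /\ exists M : R, {ae area, forall p, Dp p -> cmod (psi p) <= M}.

Definition AQ (psi : fn) := Linfty psi /\ compact_op (Hankel psi).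

Definition contCD (phi : fn) :=
  {within cDp, continuous (fun p => (ReC (phi p), ImC (phi p)))}.

Definition bounded_linear_A2 (T : fn -> fn) :=
  (forall f, A2 f -> A2 (T f)) /\
  (forall f g, A2 f -> A2 g -> eqD f g -> eqD (T f) (T g)) /\
  (forall f g (c : R[i]), A2 f -> A2 g ->
     eqD (T (fun p => f p + c * g p)) (fun p => T f p + c * T g p)) /\
  (exists C : R, forall f, A2 f -> sqnorm (T f) <= C * sqnorm f).

Definition invertible_A2 (T : fn -> fn) :=
  exists S : fn -> fn, bounded_linear_A2 S /\
    forall f, A2 f -> eqD (S (T f)) f /\ eqD (T (S f)) f.

Definition fredholm_A2 (T : fn -> fn) :=
  (exists (k : nat) (e : 'I_k -> fn), (forall i, A2 (e i)) /\
     forall f, A2 f -> eqD (T f) (fun=> 0) ->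
       exists c : 'I_k -> R[i], eqD f (fun p => \sum_(i < k) c i * e i p)) /\
  (exists (k : nat) (e : 'I_k -> fn), (forall i, A2 (e i)) /\
     forall h, A2 h -> exists g (c : 'I_k -> R[i]), A2 g /\
       eqD h (fun p => T g p + \sum_(i < k) c i * e i p)).

End Bergman.

(* Main.v *)
(* The monomials are orthogonal on every rotation-invariant subset of the disc: the
   area measure is invariant under the rotation (3 + 4i)/5, a product of three shears
   which has infinite order.  Parseval's identity on annuli bounds Taylor coefficients
   by the L^2 norm, so A^2 is complete and the projection P exists; it also bounds the
   norm of f in A^2 by its norm on an annulus c <= |z|^2 < 1.
   If T_phi is Fredholm and phi vanished at a boundary point zeta, the normalized
   peak functions f_n of zeta, powers of 1 + conj(zeta) z, would satisfy
   conj(phi) f_n -> 0 in norm and f_n -> 0 weakly.  Since the range of T_phi has finite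
   codimension, <h, f_n> would be O(delta_n) for all h in A^2, with one sequence
   delta_n -> 0; a gliding hump excludes this.
   Hence Re phi >= |Im phi|^2 makes Re phi bounded below near the circle, so
   Re <T_phi f, f> >= k |f|^2, and a coercive operator is invertible. *)
Require Import Defs.
From HB Require Import structures.
From mathcomp Require Import all_boot all_order all_algebra.
From mathcomp Require Import all_classical all_reals all_analysis.
From mathcomp.real_closed Require Import complex.
From mathcomp Require Import measurable_realfun zify ring lra.
Import Order.TTheory GRing.Theory Num.Theory.
Import numFieldNormedType.Exports.
Import Normc.
Local Open Scope classical_set_scope.
Local Open Scope ring_scope.

Set Implicit Arguments.
Unset Strict Implicit.
Unset Printing Implicit Defensive.

(** * Invariance of area under shears and under one rotation of infinite order *)

Section Measure.
Variable R : realType.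
Local Notation leb := (@lebesgue_measure R).
Local Notation mu := (@area R).

(** The Fredholm property is stated algebraically, so no closedness of the range and no estimate
    comes with a solution g, c of h = T g + sum c_i e_i. Pairing with a peak function only gives
    |<h, f_n>| <= C_h delta_n, where C_h depends on h in an uncontrolled way; what matters is that
    delta_n does not depend on h. The gliding hump turns this pointwise information into a
    contradiction. Zeros of phi inside the disc are harmless: an analytic function cannot carry more
    than a fixed proportion of its squared norm on a smaller concentric disc, so a lower bound of Re
    phi near the circle is enough. On the circle the inequality survives by continuity, and Re phi =
    0 then forces Im phi = 0; nonvanishing is therefore all that has to be extracted there. One
    rotation of infinite order does the work of polar coordinates: the integral of z^n conj(z)^m
    over an invariant set is multiplied by w^(n-m), which is 1 only for n = m. *)

Lemma lebesgue_measure_translate (a : R) (A : set R) : measurable A ->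
  leb ((fun x => x + a) @^-1` A) = leb A.
Proof.
move=> mA.
have ms : measurable_fun [set: measurableTypeR R] (fun x : measurableTypeR R => (x + a : measurableTypeR R)).
  by apply: measurable_funD => //; exact: measurable_cst.
pose f : {mfun (measurableTypeR R) >-> (measurableTypeR R)} := HB.pack (fun x : R => x + a)
  (isMeasurableFun.Build _ _ _ _ _ ms).
rewrite -[LHS]/(pushforward leb f A); apply/esym.
apply: (@lebesgue_measure_unique R (pushforward leb f)) => //.
move=> _ [[b c]/= bc <-].
rewrite /pushforward.
have -> : f @^-1` `]b, c] = `]b - a, c - a]%classic.
  by apply/seteqP; split => x /=; rewrite !in_itv/= ltrBlDr lerBrDr.
by rewrite !lebesgue_measure_itv/= !lte_fin ltrD2r; case: ifP => // _;
   rewrite -!EFinB; congr EFin; lra.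
Qed.

(** [area] integrates the lengths of vertical sections. The horizontal shear translates horizontal
    sections, hence the passage to the other order of integration. *)
Lemma area_product2 (X : set (R * R)) : measurable X ->
  mu X = ((leb \x^ leb)%E X).
Proof.
move=> mX; apply: (@product_measure_unique _ _ _ _ R leb leb) => // A B mA mB.
by rewrite /= product_measure2E.
Qed.

Definition shear1 (t : R) (p : R * R) : R * R := (p.1 + t * p.2, p.2).
Definition shear2 (t : R) (p : R * R) : R * R := (p.1, p.2 + t * p.1).

Lemma measurable_shear1 t : measurable_fun [set: R * R] (shear1 t).
Proof.
apply/measurable_fun_pairP; split => /=.
  apply: measurable_funD; first exact: measurable_fst.
  by apply: measurable_funM; [exact: measurable_cst|exact: measurable_snd].
exact: measurable_snd.
Qed.

Lemma measurable_shear2 t : measurable_fun [set: R * R] (shear2 t).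
Proof.
apply/measurable_fun_pairP; split => /=.
  exact: measurable_fst.
apply: measurable_funD; first exact: measurable_snd.
by apply: measurable_funM; [exact: measurable_cst|exact: measurable_fst].
Qed.

Lemma measurable_preimage d d' (T : measurableType d) (T' : measurableType d')
  (f : T -> T') (X : set T') : measurable_fun setT f -> measurable X ->
  measurable (f @^-1` X).
Proof. by move=> mf mX; rewrite -[X in measurable X]setTI; exact: mf. Qed.

(** Each vertical section of the preimage is a translate of the corresponding section of X. *)
Lemma area_shear2 t (X : set (R * R)) : measurable X ->
  mu (shear2 t @^-1` X) = mu X.
Proof.
move=> mX; rewrite /area /product_measure1 /=.
apply: eq_integral => x _ /=.
rewrite -[RHS](lebesgue_measure_translate (t * x)); last exact: measurable_xsection.
by congr (leb _); apply/seteqP; split => y /=; rewrite !xsectionE.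
Qed.

Lemma area_shear1 t (X : set (R * R)) : measurable X ->
  mu (shear1 t @^-1` X) = mu X.
Proof.
move=> mX; rewrite !area_product2//; last first.
  by apply: measurable_preimage => //; exact: measurable_shear1.
apply: eq_integral => x _ /=.
rewrite -[RHS](lebesgue_measure_translate (t * x)); last exact: measurable_ysection.
by congr (leb _); apply/seteqP; split => y /=; rewrite !ysectionE.
Qed.

(* Multiplication by (3 + 4i)/5, a rotation of infinite order. *)
Definition rot (p : R * R) : R * R :=
  (3 / 5 * p.1 - 4 / 5 * p.2, 4 / 5 * p.1 + 3 / 5 * p.2).

(** A rotation by theta is a product of shears with parameters -tan(theta/2), sin(theta),
    -tan(theta/2); here cos = 3/5, sin = 4/5 and tan(theta/2) = (4/5) / (1 + 3/5) = 1/2. *)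
Lemma rot_shears p : rot p = shear1 (- (1 / 2)) (shear2 (4 / 5) (shear1 (- (1 / 2)) p)).
Proof. by rewrite /rot /shear1 /shear2 /=; congr pair; lra. Qed.

Lemma measurable_rot : measurable_fun [set: R * R] rot.
Proof.
rewrite (_ : rot = shear1 (- (1 / 2)) \o (shear2 (4 / 5) \o shear1 (- (1 / 2)))); last first.
  by apply/funext => p; rewrite rot_shears.
apply: measurableT_comp; first exact: measurable_shear1.
by apply: measurableT_comp; [exact: measurable_shear2|exact: measurable_shear1].
Qed.

Lemma area_rot (X : set (R * R)) : measurable X ->
  mu (rot @^-1` X) = mu X.
Proof.
move=> mX.
have -> : rot @^-1` X =
    shear1 (- (1 / 2)) @^-1` (shear2 (4 / 5) @^-1` (shear1 (- (1 / 2)) @^-1` X)).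
  by apply/seteqP; split => p /=; rewrite rot_shears.
have m1 : measurable (shear1 (- (1 / 2)) @^-1` X).
  by apply: measurable_preimage => //; exact: measurable_shear1.
have m2 := measurable_preimage (@measurable_shear2 (4 / 5)) m1.
by rewrite area_shear1// area_shear2// area_shear1.
Qed.

Local Notation RR := (measurableTypeR R * measurableTypeR R)%type.

(** Change of variables through the pushforward of [mu] under [rot], which agrees with [mu] on
    measurable sets by [area_rot]. *)
Lemma integral_rot (A : set RR) (F : RR -> R) :
  measurable A -> rot @^-1` A = A -> measurable_fun setT F ->
  mu.-integrable A (EFin \o F) ->
  Rintegral mu A (F \o rot) = Rintegral mu A F.
Proof.
move=> mA rA mF iF.
have mr : @measurable_fun _ _ RR RR setT rot by exact: measurable_rot.
pose f : {mfun RR >-> RR} := HB.pack (rot : RR -> RR)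
  (isMeasurableFun.Build _ _ _ _ _ mr).
rewrite /Rintegral; congr fine.
have pE B : measurable B -> B `<=` A -> mu B = pushforward mu f B.
  by move=> mB _; rewrite /pushforward area_rot.
have iFp : (pushforward mu f).-integrable A (EFin \o F).
  case/integrableP: iF => m1 i1; apply/integrableP; split; first exact: m1.
  apply: le_lt_trans i1.
  rewrite (@eq_measure_integral _ _ _ A mu (pushforward mu f)) => [|B mB BA].
    exact: lexx.
  exact: (esym (pE _ mB BA)).
have mEF : measurable_fun [set: RR] (EFin \o F) by exact/measurable_EFinP.
have iFr : mu.-integrable (f @^-1` A) ((EFin \o F) \o f).
  case/integrableP: iFp => m1; rewrite ge0_integral_pushforward//; last first.
    exact: measurableT_comp.
  move=> i1; apply/integrableP; split; last exact: i1.
  by apply: measurable_funTS; apply: measurableT_comp.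
rewrite -[X in X = _]/(\int[mu]_(x in A) ((EFin \o F) \o f) x)%E.
rewrite -{1}rA -(integral_pushforward mr mEF iFr mA).
by apply: eq_measure_integral => B mB BA; exact: (esym (pE _ mB BA)).
Qed.

End Measure.

(** * Complex arithmetic by real and imaginary parts; the area of simple sets *)

Section Basics.
Variable R : realType.
Local Notation mu := (@area R).
Local Notation RR := (measurableTypeR R * measurableTypeR R)%type.
Local Notation mfun A f := (@measurable_fun _ _ RR R A f).
Local Notation Dp := (@Dp R).
Implicit Types (x y z : R[i]).

Definition r2 (p : R * R) : R := p.1 ^+ 2 + p.2 ^+ 2.
Definition n2 z : R := ReC z ^+ 2 + ImC z ^+ 2.
Definition dotc x y : R := ReC x * ReC y + ImC x * ImC y.

Lemma ReCD x y : ReC (x + y) = ReC x + ReC y. Proof. by case: x; case: y. Qed.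
Lemma ImCD x y : ImC (x + y) = ImC x + ImC y. Proof. by case: x; case: y. Qed.
Lemma ReCN x : ReC (- x) = - ReC x. Proof. by case: x. Qed.
Lemma ImCN x : ImC (- x) = - ImC x. Proof. by case: x. Qed.
Lemma ReCM x y : ReC (x * y) = ReC x * ReC y - ImC x * ImC y.
Proof. by case: x; case: y. Qed.
Lemma ImCM x y : ImC (x * y) = ReC x * ImC y + ImC x * ReC y.
Proof. by case: x => a b; case: y => c d; rewrite /ImC /ReC /=. Qed.
Lemma ReCJ x : ReC (cconj x) = ReC x. Proof. by case: x. Qed.
Lemma ImCJ x : ImC (cconj x) = - ImC x. Proof. by case: x. Qed.
Lemma ReCr (t : R) : ReC (t%:C)%C = t. Proof. by []. Qed.
Lemma ImCr (t : R) : ImC (t%:C)%C = 0. Proof. by []. Qed.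
Lemma ReC0 : ReC (0 : R[i]) = 0. Proof. by []. Qed.
Lemma ImC0 : ImC (0 : R[i]) = 0. Proof. by []. Qed.
Lemma ReC1 : ReC (1 : R[i]) = 1. Proof. by []. Qed.
Lemma ImC1 : ImC (1 : R[i]) = 0. Proof. by []. Qed.
Lemma ReCi : ReC ('i%C : R[i]) = 0. Proof. by []. Qed.
Lemma ImCi : ImC ('i%C : R[i]) = 1. Proof. by []. Qed.
Lemma ReCn n : ReC (n%:R : R[i]) = n%:R.
Proof. by elim: n => // n IH; rewrite -!natr1 ReCD IH. Qed.
Lemma ImCn n : ImC (n%:R : R[i]) = 0.
Proof. by elim: n => // n IH; rewrite -natr1 ImCD IH addr0. Qed.
Definition cE := (ReCn, ImCn, ReCD, ImCD, ReCN, ImCN, ReCM, ImCM, ReCJ, ImCJ, ReCr, ImCr,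
  ReC0, ImC0, ReC1, ImC1, ReCi, ImCi).

Lemma complex_ext x y : ReC x = ReC y -> ImC x = ImC y -> x = y.
Proof. by case: x => a b; case: y => c d /= -> ->. Qed.

Lemma n2_ge0 z : 0 <= n2 z. Proof. by rewrite addr_ge0// sqr_ge0. Qed.
Lemma cmodE z : cmod z = normc z. Proof. by case: z. Qed.
Lemma cmod_sqr z : cmod z ^+ 2 = n2 z.
Proof. by rewrite /cmod sqr_sqrtr// n2_ge0. Qed.
Lemma cmod_ge0 z : 0 <= cmod z. Proof. exact: sqrtr_ge0. Qed.
Lemma cmodM x y : cmod (x * y) = cmod x * cmod y.
Proof. by rewrite !cmodE normcM. Qed.
Lemma cmodD x y : cmod (x + y) <= cmod x + cmod y.
Proof. by rewrite !cmodE le_normcD. Qed.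
Lemma cmodN x : cmod (- x) = cmod x.
Proof. by rewrite !cmodE normcN. Qed.
Lemma cmod0 : cmod (0 : R[i]) = 0. Proof. by rewrite cmodE normc0. Qed.
Lemma cmod1 : cmod (1 : R[i]) = 1. Proof. by rewrite cmodE normc1. Qed.
Lemma cmod_eq0 x : cmod x = 0 -> x = 0. Proof. by rewrite cmodE => /eq0_normc. Qed.
Lemma cmodX x n : cmod (x ^+ n) = cmod x ^+ n.
Proof. by elim: n => [|n IH]; rewrite ?expr0 ?cmod1// !exprS cmodM IH. Qed.
Lemma cmod_sum (n : nat) (F : nat -> R[i]) :
  cmod (\sum_(i < n) F i) <= \sum_(i < n) cmod (F i).
Proof.
elim: n => [|n IH]; first by rewrite !big_ord0 cmod0.
by rewrite !big_ord_recr/= (le_trans (cmodD _ _))// lerD2r.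
Qed.
Lemma n2M x y : n2 (x * y) = n2 x * n2 y.
Proof. by rewrite /n2 !cE; ring. Qed.
Lemma n2_le0 x : n2 x <= 0 -> x = 0.
Proof.
rewrite -cmod_sqr => h; apply: cmod_eq0; apply/eqP; rewrite -sqrf_eq0 eq_le h.
exact: sqr_ge0.
Qed.
Lemma cmodr (t : R) : 0 <= t -> cmod (t%:C)%C = t.
Proof. by move=> t0; rewrite /cmod !cE expr0n/= addr0 sqrtr_sqr ger0_norm. Qed.
Lemma normr_ReC x : `|ReC x| <= cmod x.
Proof. by rewrite -sqrtr_sqr ler_sqrt ?addr_ge0 ?sqr_ge0// lerDl sqr_ge0. Qed.
Lemma normr_ImC x : `|ImC x| <= cmod x.
Proof. by rewrite -sqrtr_sqr ler_sqrt ?addr_ge0 ?sqr_ge0// lerDr sqr_ge0. Qed.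
Lemma cmod_le_ReIm x : cmod x <= `|ReC x| + `|ImC x|.
Proof.
rewrite -[leRHS]ger0_norm ?addr_ge0// -sqrtr_sqr ler_sqrt ?sqr_ge0//.
rewrite sqrrD !real_normK ?num_real// -addrA lerD2l lerDr.
by rewrite mulrn_wge0// mulr_ge0.
Qed.
Lemma dotcc x : dotc x x = n2 x. Proof. by rewrite /dotc /n2 !expr2. Qed.
Lemma dotc_le x y : `|dotc x y| <= n2 x + n2 y.
Proof.
rewrite ler_norml /dotc /n2; apply/andP; split.
  have := sqr_ge0 (ReC x + ReC y); have := sqr_ge0 (ImC x + ImC y).
  have := sqr_ge0 (ReC x); have := sqr_ge0 (ImC x).
  have := sqr_ge0 (ReC y); have := sqr_ge0 (ImC y). nra.
have := sqr_ge0 (ReC x - ReC y); have := sqr_ge0 (ImC x - ImC y).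
have := sqr_ge0 (ReC x); have := sqr_ge0 (ImC x).
have := sqr_ge0 (ReC y); have := sqr_ge0 (ImC y). nra.
Qed.
Lemma n2_zc p : n2 (zc p) = r2 p. Proof. by []. Qed.

Lemma r2_ge0 p : 0 <= r2 p. Proof. by rewrite addr_ge0// sqr_ge0. Qed.

Lemma measurable_r2 : mfun setT r2.
Proof.
apply: measurable_funD; apply: measurable_funX.
  exact: measurable_fst.
exact: measurable_snd.
Qed.

Lemma measurable_sublevel (F : RR -> R) c : mfun setT F ->
  measurable [set p : RR | F p < c].
Proof.
move=> mF; rewrite (_ : [set p | _] = F @^-1` `]-oo, c[%classic).
  exact: measurable_preimage.
by apply/seteqP; split => p /=; rewrite in_itv.
Qed.

Definition rdisc (c : R) : set RR := [set p | r2 p < c].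

Lemma measurable_rdisc c : measurable (rdisc c).
Proof. exact: measurable_sublevel measurable_r2. Qed.

Lemma DpE : Dp = rdisc 1. Proof. by []. Qed.

Lemma measurable_Dp : measurable (Dp : set RR).
Proof. exact: measurable_rdisc. Qed.

Lemma leb_itv (a b : R) : a < b ->
  (@lebesgue_measure R `]a, b[%classic = (b - a)%:E)%E.
Proof. by move=> ab; rewrite lebesgue_measure_itv/= lte_fin ab EFinB. Qed.

Lemma mu_box (a b c d : R) : a < b -> c < d ->
  mu (`]a, b[ `*` `]c, d[) = ((b - a) * (d - c))%:E.
Proof.
move=> ab cd; rewrite /area product_measure1E; [|exact: measurable_itv..].
by rewrite EFinM; congr (_ * _)%E; exact: leb_itv.
Qed.

Lemma mu_Dp : (mu Dp < +oo)%E.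
Proof.
apply: (@le_lt_trans _ _ (mu (`]-2, 2[ `*` `]-2, 2[)%classic)); last first.
  by rewrite mu_box; [rewrite ltry|lra..].
apply: le_measure; rewrite ?inE.
- exact: measurable_Dp.
- by apply: measurableX; exact: measurable_itv.
move=> [x y]; rewrite DpE /rdisc /r2 /= !in_itv /= => h.
have := sqr_ge0 x; have := sqr_ge0 y => y0 x0.
by split; apply/andP; split; nra.
Qed.

Lemma mu_sub_Dp (A : set RR) : measurable A -> A `<=` Dp -> (mu A < +oo)%E.
Proof.
by move=> mA AD; apply: le_lt_trans mu_Dp; apply: le_measure; rewrite ?inE//; exact: measurable_Dp.
Qed.

Lemma mu_nbhs_gt0 (O : set RR) (p : R * R) : measurable O ->
  nbhs (p : (R * R)%type) (O : set (R * R)) -> (0 < mu O)%E.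
Proof.
case: p => a b mO /nbhs_ballP[e /= e0 eO].
apply: (@lt_le_trans _ _ (mu (`]a - e, a + e[ `*` `]b - e, b + e[)%classic)).
  rewrite mu_box ?lte_fin; [|lra..].
  by rewrite mulr_gt0//; lra.
apply: le_measure; rewrite ?inE//.
  by apply: measurableX; exact: measurable_itv.
move=> [x y] /= [+ +]; rewrite !in_itv /= => /andP[x1 x2] /andP[y1 y2].
by apply: eO; split; rewrite /ball /= ltr_norml; lra.
Qed.

End Basics.

(** * The space L^2 of the disc with a real inner product *)

Section L2space.
Variable R : realType.
Local Notation mu := (@area R).
Local Notation RR := (measurableTypeR R * measurableTypeR R)%type.
Local Notation mfun A f := (@measurable_fun _ _ RR R A f).
Local Notation Dp := (@Dp R).
Local Notation ig A F := (mu.-integrable (A : set RR) (EFin \o (F : RR -> R))).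
Implicit Types (f g h : fn R).

Lemma measC_Re f : measC f -> mfun Dp (fun p => ReC (f p)). Proof. by case. Qed.
Lemma measC_Im f : measC f -> mfun Dp (fun p => ImC (f p)). Proof. by case. Qed.

Lemma measCP f : mfun Dp (fun p => ReC (f p)) -> mfun Dp (fun p => ImC (f p)) -> measC f.
Proof. by move=> a b; split; [exact: a|exact: b]. Qed.

Lemma measC_n2 f : measC f -> mfun Dp (fun p => n2 (f p)).
Proof.
move=> mf; apply: measurable_funD; apply: measurable_funX.
  exact: measC_Re.
exact: measC_Im.
Qed.

Lemma measC_dot f g : measC f -> measC g -> mfun Dp (fun p => dotc (f p) (g p)).
Proof.
move=> mf mg; apply: measurable_funD; apply: measurable_funM;
  solve [exact: measC_Re|exact: measC_Im].
Qed.

Lemma measCM f g : measC f -> measC g -> measC (fun p => f p * g p).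
Proof.
move=> mf mg; apply: measCP.
  under eq_fun do rewrite ReCM.
  apply: measurable_funB; apply: measurable_funM; solve [exact: measC_Re|exact: measC_Im].
under eq_fun do rewrite ImCM.
apply: measurable_funD; apply: measurable_funM; solve [exact: measC_Re|exact: measC_Im].
Qed.

Lemma measCD f g : measC f -> measC g -> measC (fun p => f p + g p).
Proof.
move=> mf mg; apply: measCP.
  under eq_fun do rewrite ReCD.
  by apply: measurable_funD; exact: measC_Re.
under eq_fun do rewrite ImCD.
by apply: measurable_funD; exact: measC_Im.
Qed.

Lemma measC_cst (c : R[i]) : measC (fun=> c).
Proof. by apply: measCP; exact: measurable_cst. Qed.

Lemma measC_conj f : measC f -> measC (fun p => cconj (f p)).
Proof.
move=> mf; apply: measCP.
  by under eq_fun do rewrite ReCJ; exact: measC_Re.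
under eq_fun do rewrite ImCJ.
by apply: measurable_funN; exact: measC_Im.
Qed.

Lemma measC_zc : measC (@zc R).
Proof.
apply: measCP; apply: measurable_funTS; [exact: measurable_fst|exact: measurable_snd].
Qed.

Lemma measCX f n : measC f -> measC (fun p => f p ^+ n).
Proof.
move=> mf; elim: n => [|n IH]; first by under eq_fun do rewrite expr0; exact: measC_cst.
by under eq_fun do rewrite exprS; exact: measCM.
Qed.

Lemma eqD_mfun (F G : RR -> R) : (forall p, Dp p -> F p = G p) -> mfun Dp F -> mfun Dp G.
Proof. by move=> FG; apply: eq_measurable_fun => p /set_mem Dp_; exact: FG. Qed.

Lemma measC_eqD f g : eqD f g -> measC f -> measC g.
Proof.
move=> fg mf; apply: measCP.
  by apply: eqD_mfun (measC_Re mf) => p Dpp; rewrite fg.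
by apply: eqD_mfun (measC_Im mf) => p Dpp; rewrite fg.
Qed.

Lemma L2P f : L2 f <-> measC f /\ ig Dp (fun p => n2 (f p)).
Proof.
have E : (\int[mu]_(p in Dp) (cmod (f p) ^+ 2)%:E = \int[mu]_(p in Dp) `|(EFin \o (fun p => n2 (f p))) p|)%E.
  by apply: eq_integral => p _; rewrite cmod_sqr /= ger0_norm// n2_ge0.
split=> -[mf].
  move=> fin; split=> //; apply/integrableP; split.
    by apply/measurable_EFinP; exact: measC_n2.
  by rewrite -E.
by move/integrableP => [_ fin]; split => //; rewrite E.
Qed.

Lemma L2_measC f : L2 f -> measC f. Proof. by case. Qed.
Lemma L2_ign2 f : L2 f -> ig Dp (fun p => n2 (f p)). Proof. by move/L2P => []. Qed.

Lemma igD A F G : ig A F -> ig A G -> measurable (A : set RR) -> ig A (fun p => F p + G p).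
Proof.
move=> iF iG mA.
rewrite (_ : EFin \o _ = (EFin \o F) \+ (EFin \o G))%E//.
exact: integrableD.
Qed.

Lemma igZ A F (k : R) : ig A F -> measurable (A : set RR) -> ig A (fun p => k * F p).
Proof.
move=> iF mA.
rewrite (_ : EFin \o _ = (fun p => k%:E * (EFin \o F) p))%E//.
exact: integrableZl.
Qed.

Lemma ig_le A F G : measurable (A : set RR) -> mfun A F -> ig A G -> (forall p, A p -> `|F p| <= G p) -> ig A F.
Proof.
move=> mA mF iG FG; apply: le_integrable iG => //; first exact/measurable_EFinP.
by move=> p Ap /=; rewrite lee_fin (le_trans (FG _ Ap))// ler_norm.
Qed.

Lemma igS (A A' : set RR) F : measurable A -> measurable A' -> A' `<=` A -> ig A F -> ig A' F.
Proof. by move=> mA mA' AA; exact: integrableS. Qed.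

Lemma ig_bounded (A : set RR) F M : measurable A -> A `<=` Dp -> mfun A F ->
  (forall p, A p -> `|F p| <= M) -> ig A F.
Proof.
move=> mA AD mF FM; apply: measurable_bounded_integrable => //.
  exact: mu_sub_Dp.
exists M; split; first exact: num_real.
by move=> k Mk p /= Ap; rewrite (le_trans (FM _ Ap))// ltW.
Qed.

Lemma L2_igdot f g : L2 f -> L2 g -> ig Dp (fun p => dotc (f p) (g p)).
Proof.
move=> Lf Lg.
apply: (@ig_le _ _ (fun p => n2 (f p) + n2 (g p))).
- exact: measurable_Dp.
- by apply: measC_dot; exact: L2_measC.
- by apply: igD; [exact: L2_ign2..|exact: measurable_Dp].
- by move=> p _; exact: dotc_le.
Qed.

Lemma L2_lin f g (c : R[i]) : L2 f -> L2 g -> L2 (fun p => f p + c * g p).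
Proof.
move=> Lf Lg; apply/L2P.
have m : measC (fun p => f p + c * g p).
  apply: measCD; first exact: L2_measC.
  by apply: measCM; [exact: measC_cst|exact: L2_measC].
split=> //.
apply: (@ig_le _ _ (fun p => 2 * n2 (f p) + (2 * n2 c) * n2 (g p))).
- exact: measurable_Dp.
- exact: measC_n2.
- by apply: igD; [apply: igZ|apply: igZ|]; (try exact: L2_ign2); exact: measurable_Dp.
move=> p _; rewrite ger0_norm ?n2_ge0// -mulrA -n2M /n2 !ReCD !ImCD.
set a := ReC (f p); set b := ImC (f p); set x := ReC _; set y := ImC _.
have := sqr_ge0 (a - x); have := sqr_ge0 (b - y); nra.
Qed.

Lemma eqD_L2 f g : eqD f g -> L2 f -> L2 g.
Proof.
move=> fg /L2P[mf iF]; apply/L2P; split; first exact: measC_eqD mf.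
by apply: eq_integrable iF; [exact: measurable_Dp|move=> p /set_mem Dpp /=; rewrite fg].
Qed.

Lemma L2_cst (c : R[i]) : L2 (fun=> c).
Proof.
apply/L2P; split; first exact: measC_cst.
apply: (@ig_bounded _ _ (n2 c)) => //; first exact: measurable_Dp.
  by move=> p _; rewrite ger0_norm// n2_ge0.
Qed.

Lemma L2_bounded f M : measC f -> (forall p, Dp p -> cmod (f p) <= M) -> L2 f.
Proof.
move=> mf fM; apply/L2P; split => //.
apply: (@ig_bounded _ _ (M ^+ 2)) => //; first exact: measurable_Dp.
  exact: measC_n2.
move=> p Dpp; rewrite ger0_norm ?n2_ge0// -cmod_sqr ler_sqr ?nnegrE ?cmod_ge0 ?fM//.
by rewrite (le_trans (cmod_ge0 (f p)))// fM.
Qed.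

Lemma L2_scale f (c : R[i]) : L2 f -> L2 (fun p => c * f p).
Proof.
move=> Lf; apply: eqD_L2 (L2_lin c (L2_cst 0) Lf) => p _; exact: add0r.
Qed.

Lemma L2_sub f g : L2 f -> L2 g -> L2 (fun p => f p - g p).
Proof.
by move=> Lf Lg; apply: eqD_L2 (L2_lin (-1) Lf Lg) => p _; rewrite mulN1r.
Qed.

Lemma L2_add f g : L2 f -> L2 g -> L2 (fun p => f p + g p).
Proof.
by move=> Lf Lg; apply: eqD_L2 (L2_lin 1 Lf Lg) => p _; rewrite mul1r.
Qed.

Lemma n2_le_sqr (z : R[i]) M : cmod z <= M -> n2 z <= M ^+ 2.
Proof.
move=> zM; rewrite -cmod_sqr ler_sqr ?nnegrE ?cmod_ge0//.
exact: le_trans (cmod_ge0 _) zM.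
Qed.

Lemma L2_mul f g M : measC f -> (forall p, Dp p -> cmod (f p) <= M) -> L2 g ->
  L2 (fun p => f p * g p).
Proof.
move=> mf fM Lg; apply/L2P.
have m : measC (fun p => f p * g p) by apply: measCM => //; exact: L2_measC.
split => //; apply: (@ig_le _ _ (fun p => M ^+ 2 * n2 (g p))).
- exact: measurable_Dp.
- exact: measC_n2.
- by apply: igZ; [exact: L2_ign2|exact: measurable_Dp].
move=> p Dpp; rewrite ger0_norm ?n2_ge0// n2M ler_wpM2r ?n2_ge0//.
exact/n2_le_sqr/fM.
Qed.

(* B is pi Re <f, g>: real parts suffice, since Im <f, g> = Re <f, i g>. *)
Definition B f g : R := Rintegral mu Dp (fun p => dotc (f p) (g p)).
Definition nrm f : R := B f f.
Definition N f : R := Num.sqrt (nrm f).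

Lemma eqD_B f f' g g' : eqD f f' -> eqD g g' -> B f g = B f' g'.
Proof.
by move=> ff gg; apply: eq_Rintegral => p /set_mem Dpp; rewrite ff// gg.
Qed.

Lemma eqD_nrm f f' : eqD f f' -> nrm f = nrm f'.
Proof. by move=> ff; exact: eqD_B. Qed.

Lemma eqD_N f f' : eqD f f' -> N f = N f'.
Proof. by move=> ff; rewrite /N (eqD_nrm ff). Qed.

Lemma B_sym f g : B f g = B g f.
Proof. by apply: eq_Rintegral => p _; rewrite /dotc; ring. Qed.

Lemma nrmE f : nrm f = Rintegral mu Dp (fun p => n2 (f p)).
Proof. by apply: eq_Rintegral => p _; rewrite dotcc. Qed.

Lemma sqnormE f : sqnorm f = pi^-1 * nrm f.
Proof. by rewrite nrmE; congr (_ * _); apply: eq_Rintegral => p _; rewrite cmod_sqr. Qed.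

Lemma nrm_ge0 f : 0 <= nrm f.
Proof. by rewrite nrmE; apply: Rintegral_ge0 => p _; exact: n2_ge0. Qed.

Lemma N_ge0 f : 0 <= N f. Proof. exact: sqrtr_ge0. Qed.
Lemma N_sqr f : N f ^+ 2 = nrm f. Proof. by rewrite /N sqr_sqrtr// nrm_ge0. Qed.

Lemma B_lin f g h (t : R) : L2 f -> L2 g -> L2 h ->
  B (fun p => f p + (t%:C)%C * g p) h = B f h + t * B g h.
Proof.
move=> Lf Lg Lh; rewrite /B -RintegralZl; [|exact: measurable_Dp|exact: L2_igdot].
rewrite -RintegralD; [|exact: measurable_Dp|exact: L2_igdot|]; last first.
  by apply: igZ; [exact: L2_igdot|exact: measurable_Dp].
by apply: eq_Rintegral => p _; rewrite /dotc !cE; ring.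
Qed.

Lemma B_add f g h : L2 f -> L2 g -> L2 h ->
  B (fun p => f p + g p) h = B f h + B g h.
Proof.
move=> Lf Lg Lh; rewrite -[B g h]mul1r -B_lin//.
by apply: eqD_B => // p _; rewrite mul1r.
Qed.

Lemma B_sub f g h : L2 f -> L2 g -> L2 h ->
  B (fun p => f p - g p) h = B f h - B g h.
Proof.
move=> Lf Lg Lh; rewrite -mulN1r -B_lin//.
by apply: eqD_B => // p _; rewrite rmorphN1 mulN1r.
Qed.

Lemma nrm_lin f g (t : R) : L2 f -> L2 g ->
  nrm (fun p => f p + (t%:C)%C * g p) = nrm f + 2 * t * B f g + t ^+ 2 * nrm g.
Proof.
move=> Lf Lg; have Ll := L2_lin (t%:C)%C Lf Lg.
rewrite /nrm B_lin// (B_sym f) (B_sym g) !B_lin// (B_sym g f); ring.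
Qed.

Lemma nrm_sub f g : L2 f -> L2 g ->
  nrm (fun p => f p - g p) = nrm f - 2 * B f g + nrm g.
Proof.
move=> Lf Lg; transitivity (nrm f + 2 * (-1) * B f g + (-1) ^+ 2 * nrm g); last by ring.
by rewrite -nrm_lin//; apply: eqD_nrm => p _; rewrite rmorphN1 mulN1r.
Qed.

Lemma nrm_add f g : L2 f -> L2 g ->
  nrm (fun p => f p + g p) = nrm f + 2 * B f g + nrm g.
Proof.
move=> Lf Lg; transitivity (nrm f + 2 * 1 * B f g + 1 ^+ 2 * nrm g); last by ring.
by rewrite -nrm_lin//; apply: eqD_nrm => p _; rewrite mul1r.
Qed.

Lemma nrm_scale f (c : R[i]) : L2 f -> nrm (fun p => c * f p) = n2 c * nrm f.
Proof.
move=> Lf; rewrite !nrmE -RintegralZl; [|exact: measurable_Dp|exact: L2_ign2].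
by apply: eq_Rintegral => p _; rewrite n2M.
Qed.

Lemma N_scale f (c : R[i]) : L2 f -> N (fun p => c * f p) = cmod c * N f.
Proof. by move=> Lf; rewrite /N nrm_scale// sqrtrM ?n2_ge0. Qed.

Lemma CauchySchwarz f g : L2 f -> L2 g -> `|B f g| <= N f * N g.
Proof.
move=> Lf Lg.
have q t : 0 <= nrm f + 2 * t * B f g + t ^+ 2 * nrm g.
  by rewrite -nrm_lin// nrm_ge0.
suff : B f g ^+ 2 <= nrm f * nrm g.
  by move=> h; rewrite -sqrtrM ?nrm_ge0// -sqrtr_sqr ler_sqrt// mulr_ge0 ?nrm_ge0.
have [g0|g0] := eqVneq (nrm g) 0.
  (* When [nrm g] = 0 the quadratic is affine in t, and this t gives it the value -1 unless [B f g]
     = 0. *)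
  rewrite g0 mulr0; have := q (- (nrm f + 1) / (2 * B f g)).
  have [->|b0] := eqVneq (B f g) 0; first by rewrite expr0n.
  rewrite g0 mulr0 addr0 (_ : 2 * _ * _ = - (nrm f + 1)); last by field.
  by lra.
have gp : 0 < nrm g by rewrite lt_neqAle eq_sym g0 nrm_ge0.
have := q (- B f g / nrm g).
rewrite (_ : _ + _ + _ = nrm f - B f g ^+ 2 / nrm g); last by field.
by rewrite subr_ge0 ler_pdivrMr.
Qed.

Lemma N_triangle f g : L2 f -> L2 g -> N (fun p => f p + g p) <= N f + N g.
Proof.
move=> Lf Lg; have := CauchySchwarz Lf Lg => cs.
rewrite -[leRHS]ger0_norm ?addr_ge0 ?N_ge0// -sqrtr_sqr ler_sqrt ?sqr_ge0//.
rewrite nrm_add// -!N_sqr; have := ler_norm (B f g); nra.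
Qed.

Lemma N_sub_sym f g : N (fun p => f p - g p) = N (fun p => g p - f p).
Proof.
by congr Num.sqrt; rewrite !nrmE; apply: eq_Rintegral => p _; rewrite /n2 !cE; ring.
Qed.

Lemma ip_B f g : ip f g = ((pi^-1 * B f g) +i* (pi^-1 * B f (fun p => 'i%C * g p)))%C.
Proof.
rewrite /ip; congr (_ +i* _)%C; congr (_ * _); apply: eq_Rintegral => p _;
  rewrite /dotc !cE; ring.
Qed.

End L2space.

(** * Orthogonality of monomials and Parseval's identity on rotation-invariant sets *)

Section PowerSeries.
Variable R : realType.
Local Notation mu := (@area R).
Local Notation RR := (measurableTypeR R * measurableTypeR R)%type.
Local Notation mfun A f := (@measurable_fun _ _ RR R A f).
Local Notation Dp := (@Dp R).
Local Notation zc := (@zc R).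
Local Notation r2 := (@r2 R).
Local Notation ig A F := (mu.-integrable (A : set RR) (EFin \o (F : RR -> R))).
Implicit Types (f g h : fn R) (a : nat -> R[i]) (A : set RR).

Let w : R[i] := ((3 / 5) +i* (4 / 5))%C.

Lemma zc_rot p : zc (rot p) = w * zc p.
Proof. by apply: complex_ext; rewrite !cE /w /ReC /ImC //= addrC. Qed.

Lemma r2_rot p : r2 (rot p) = r2 p.
Proof. by rewrite /r2 /rot /=; field. Qed.

(* (3 + 4i)^2 = -7 + 24i is congruent to 3 + 4i modulo 5, hence so are all higher powers. *)
Lemma pow_mod5 k : exists u v : int,
  (5 * w) ^+ k.+1 = (((5 * u + 3)%:~R : R) +i* ((5 * v + 4)%:~R : R))%C.
Proof.
have w5 : 5 * w = (3 +i* 4)%C.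
  apply: complex_ext; rewrite !cE /w /ReC /ImC /=; first by field.
  by field.
elim: k => [|k [u [v IH]]].
  by exists 0, 0; rewrite expr1 w5 !mulr0 !add0r.
exists (3 * u - 4 * v - 2), (4 * u + 3 * v + 4).
rewrite exprS IH w5; apply: complex_ext; rewrite !cE /w /ReC /ImC /=.
  by rewrite !(rmorphM, rmorphB, rmorphD, rmorph_nat)/=; ring.
by rewrite !(rmorphM, rmorphB, rmorphD, rmorph_nat)/=; ring.
Qed.

(** Otherwise (5 w)^(k+1) = 5^(k+1) would be real, while its imaginary part is congruent to 4 modulo
    5. *)
Lemma w_pow_neq1 k : w ^+ k.+1 <> 1.
Proof.
move=> wk; have [u [v]] := pow_mod5 k; rewrite exprMn wk mulr1 => /(congr1 (@ImC R)).
have -> : ImC (5 ^+ k.+1 : R[i]) = 0.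
  by rewrite -natrX ImCn.
rewrite /ImC /= => /esym/eqP; rewrite intr_eq0 => /eqP h.
by lia.
Qed.

Lemma w_conj : w * cconj w = 1.
Proof. by apply: complex_ext; rewrite !cE /w /ReC /ImC /=; field. Qed.

Lemma w_powM n m : w ^+ n * cconj w ^+ m = 1 -> n = m.
Proof.
move=> h.
have e : w ^+ n = w ^+ m.
  by rewrite -[RHS]mul1r -h -mulrA -exprMn (mulrC (cconj w)) w_conj expr1n mulr1.
have w0 : w != 0.
  by apply/eqP => w0; have := w_conj; rewrite w0 mul0r => /esym/eqP; rewrite oner_eq0.
wlog nm : n m {h} e / (n <= m)%N.
  by move=> H; case/orP: (leq_total n m) => ?; [exact: H|apply/esym/H].
apply/eqP; rewrite eqn_leq nm leqNgt /=; apply/negP => lt.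
have : w ^+ (m - n) = 1.
  apply: (mulfI (expf_neq0 n w0)); rewrite -exprD subnKC//.
  by rewrite mulr1.
by rewrite -(@prednK (m - n)) ?subn_gt0// => /w_pow_neq1.
Qed.

Lemma cconjM (x y : R[i]) : cconj (x * y) = cconj x * cconj y.
Proof. by apply: complex_ext; rewrite !cE; ring. Qed.

Lemma cconjX (x : R[i]) n : cconj (x ^+ n) = cconj x ^+ n.
Proof.
elim: n => [|n IH]; first by apply: complex_ext; rewrite !cE// oppr0.
by rewrite !exprS cconjM IH.
Qed.

Lemma cconjK (x : R[i]) : cconj (cconj x) = x.
Proof. by apply: complex_ext; rewrite !cE// opprK. Qed.

Lemma dotcE (x y : R[i]) : dotc x y = ReC (x * cconj y).
Proof. by rewrite /dotc !cE; ring. Qed.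

Lemma cmod_zc_le1 p : Dp p -> cmod (zc p) <= 1.
Proof.
move=> Dpp; rewrite -(@ler_sqr _ (cmod _) 1) ?nnegrE ?cmod_ge0// cmod_sqr n2_zc expr1n.
exact: ltW.
Qed.

Lemma L2_zcX n : L2 (fun p => zc p ^+ n).
Proof.
apply: (@L2_bounded _ _ 1); first by apply: measCX; exact: measC_zc.
by move=> p Dpp; rewrite cmodX exprn_ile1 ?cmod_ge0 ?cmod_zc_le1.
Qed.

Definition PS a N : fn R := fun p => \sum_(n < N) a n * zc p ^+ n.

Lemma L2_sum N (F : nat -> fn R) : (forall i, L2 (F i)) -> L2 (fun p => \sum_(i < N) F i p).
Proof.
move=> LF; elim: N => [|N IH].
  by under eq_fun do rewrite big_ord0; exact: L2_cst.
by under eq_fun do rewrite big_ord_recr/=; exact: L2_add.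
Qed.

Lemma L2_PS a N : L2 (PS a N).
Proof.
apply: (@L2_sum N (fun n p => a n * zc p ^+ n)) => n.
by apply: L2_scale; exact: L2_zcX.
Qed.

(** Bounding |z|^2 instead of |z| makes |z|^(2n) lie between c^n and d^n. With half-open bounds,
    [ann 0 c] and [ann c 1] partition the disc. *)
Definition ann (c d : R) : set RR := [set p | c <= r2 p < d].

Lemma measurable_ann c d : measurable (ann c d).
Proof.
have -> : ann c d = rdisc d `\` rdisc c.
  apply/seteqP; split => p /=; rewrite /ann /rdisc /=.
    by move=> /andP[cp ->]; split => //; apply/negP; rewrite -leNgt.
  by move=> [-> /negP]; rewrite -leNgt => ->.
by apply: measurableD; exact: measurable_rdisc.
Qed.

Lemma ann_Dp c d : d <= 1 -> ann c d `<=` Dp.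
Proof. by move=> d1 p /andP[_ h]; exact: lt_le_trans h d1. Qed.

Lemma rot_ann c d : (@rot R) @^-1` ann c d = ann c d.
Proof. by apply/seteqP; split => p; rewrite /ann /= r2_rot. Qed.

(** The squared norm of z^n on A, which is the weight of the n-th coefficient in Parseval's
    identity. *)
Definition wgt A n : R := Rintegral mu A (fun p => r2 p ^+ n).

Section Orthogonality.
Variable A : set RR.
Hypotheses (mA : measurable A) (AD : A `<=` Dp) (rA : (@rot R) @^-1` A = A).

Lemma ig_sub F : ig Dp F -> ig A F.
Proof. by apply: igS => //; exact: measurable_Dp. Qed.

Lemma mfunT_zcX n : mfun setT (fun p => ReC (zc p ^+ n)) /\ mfun setT (fun p => ImC (zc p ^+ n)).
Proof.
elim: n => [|n [IH1 IH2]]; first by split; exact: measurable_cst.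
split; under eq_fun do rewrite exprS ?ReCM ?ImCM.
  by apply: measurable_funB; apply: measurable_funM => //;
    [exact: measurable_fst|exact: measurable_snd].
by apply: measurable_funD; apply: measurable_funM => //;
    [exact: measurable_fst|exact: measurable_snd].
Qed.

Lemma mfunT_dot n m (c : R[i]) : mfun setT (fun p => dotc (zc p ^+ n) (c * zc p ^+ m)).
Proof.
have [n1 n2] := mfunT_zcX n; have [m1 m2] := mfunT_zcX m.
under eq_fun do rewrite /dotc ReCM ImCM.
apply: measurable_funD; apply: measurable_funM => //.
  by apply: measurable_funB; apply: measurable_funM => //; exact: measurable_cst.
by apply: measurable_funD; apply: measurable_funM => //; exact: measurable_cst.
Qed.

Lemma ig_dot n m (c : R[i]) : ig A (fun p => dotc (zc p ^+ n) (c * zc p ^+ m)).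
Proof. by apply/ig_sub/L2_igdot; [exact: L2_zcX|apply/L2_scale/L2_zcX]. Qed.

Lemma orth_monomials n m (c : R[i]) : n <> m ->
  Rintegral mu A (fun p => dotc (zc p ^+ n) (c * zc p ^+ m)) = 0.
Proof.
move=> nm.
pose F k p := dotc (zc p ^+ n) (k * zc p ^+ m).
(* J is the complex integral of z^n conj(z)^m over A; its real and imaginary parts are the values of
   the integral at c = 1 and c = i. *)
pose J := (Rintegral mu A (F 1) +i* Rintegral mu A (F 'i%C))%C : R[i].
pose k := w ^+ n * cconj w ^+ m.
have lin (d : R[i]) : Rintegral mu A (F d) = ReC d * ReC J + ImC d * ImC J.
  rewrite -RintegralZl//; last exact: ig_dot.
  rewrite -RintegralZl//; last exact: ig_dot.
  rewrite -RintegralD//; try (by apply: igZ => //; exact: ig_dot).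
  by apply: eq_Rintegral => p _; rewrite /F /dotc !cE; ring.
have kc : cconj k = cconj (w ^+ n) * w ^+ m.
  rewrite /k -cconjX cconjM; congr (_ * _).
  exact: cconjK.
(* The rotation multiplies z^n by w^n and z^m by w^m; moved to the second argument, the two factors
   become conj(k). *)
have rotF (d : R[i]) : Rintegral mu A (F d) = Rintegral mu A (F (cconj k * d)).
  rewrite -(integral_rot mA rA); [|exact: mfunT_dot|exact: ig_dot].
  apply: eq_Rintegral => p _; rewrite /= /F zc_rot !exprMn kc.
  set x := w ^+ n; set y := zc p ^+ n; set u := zc p ^+ m; set v := w ^+ m.
  by rewrite !dotcE !cconjM cconjK; congr ReC; ring.
have kJ : J = k * J.
  have h1 := rotF 1; have hi := rotF 'i%C.
  rewrite !lin !cE in h1 hi.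
  apply: complex_ext; rewrite !cE; lra.
have : (k - 1) * J = 0 by rewrite mulrBl mul1r -kJ subrr.
move/eqP; rewrite mulf_eq0 subr_eq0 => /orP[/eqP/w_powM//|/eqP J0].
by rewrite -[LHS]/(Rintegral mu A (F c)) lin J0 !mulr0 addr0.
Qed.

Lemma orth_PS a N m (c : R[i]) : (N <= m)%N ->
  Rintegral mu A (fun p => dotc (PS a N p) (c * zc p ^+ m)) = 0.
Proof.
have Lc : L2 (fun p => c * zc p ^+ m) by apply/L2_scale/L2_zcX.
elim: N => [_|N IH Nm].
  under eq_Rintegral do rewrite /PS big_ord0 /dotc !cE !mul0r addr0.
  by rewrite Rintegral_cst// mul0r.
transitivity (Rintegral mu A (fun p => dotc (PS a N p) (c * zc p ^+ m)) +
  Rintegral mu A (fun p => dotc (zc p ^+ N) ((cconj (a N) * c) * zc p ^+ m))).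
  rewrite -RintegralD//; last exact: ig_dot.
    by apply: eq_Rintegral => p _; rewrite /PS big_ord_recr /= /dotc !cE; ring.
  by apply/ig_sub/L2_igdot; [exact: L2_PS|].
rewrite IH 1?ltnW// orth_monomials ?addr0// => NE.
by rewrite NE ltnn in Nm.
Qed.

Lemma parseval_PS a N :
  Rintegral mu A (fun p => n2 (PS a N p)) = \sum_(n < N) n2 (a n) * wgt A n.
Proof.
elim: N => [|N IH].
  rewrite big_ord0; under eq_Rintegral do rewrite /PS big_ord0 /n2 !cE expr0n addr0.
  by rewrite Rintegral_cst// mul0r.
rewrite big_ord_recr /= -IH.
have Lt : L2 (fun p => a N * zc p ^+ N) by apply/L2_scale/L2_zcX.
have r2E p : n2 (zc p ^+ N) = r2 p ^+ N.
  by rewrite -cmod_sqr cmodX -n2_zc -cmod_sqr -!exprM mulnC.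
have igr : ig A (fun p => r2 p ^+ N).
  apply: eq_integrable (ig_sub (L2_ign2 (L2_zcX N))) => // p _ /=.
  by rewrite r2E.
rewrite /wgt -RintegralZl//.
transitivity (Rintegral mu A (fun p => n2 (PS a N p)) +
  (2 * Rintegral mu A (fun p => dotc (PS a N p) (a N * zc p ^+ N)) +
  Rintegral mu A (fun p => n2 (a N) * r2 p ^+ N))); last first.
  by rewrite orth_PS// mulr0 add0r.
have igd : ig A (fun p => dotc (PS a N p) (a N * zc p ^+ N)).
  by apply/ig_sub/L2_igdot; [exact: L2_PS|].
rewrite -RintegralZl// -!RintegralD//.
- by apply: eq_Rintegral => p _; rewrite -r2E -n2M /PS big_ord_recr /= /dotc /n2 !cE; ring.
- exact/ig_sub/L2_ign2/L2_PS.
- by apply: igD => //; apply: igZ.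
- exact: igZ.
- exact: igZ.
Qed.

End Orthogonality.

End PowerSeries.

(** * Functions given by power series and convergence of their partial sums *)

Section Analytic.
Variable R : realType.
Local Notation mu := (@area R).
Local Notation RR := (measurableTypeR R * measurableTypeR R)%type.
Local Notation mfun A f := (@measurable_fun _ _ RR R A f).
Local Notation Dp := (@Dp R).
Local Notation zc := (@zc R).
Local Notation r2 := (@r2 R).
Local Notation ig A F := (mu.-integrable (A : set RR) (EFin \o (F : RR -> R))).
Implicit Types (f g h : fn R) (a b : nat -> R[i]) (A : set RR).

Lemma cvgn_epsP (u : nat -> R) (l : R) : u @ \oo --> l <->
  forall e, 0 < e -> exists M : nat, forall n, (M <= n)%N -> `|u n - l| < e.
Proof.
split.
  move=> /cvgrPdist_lt h e e0; have [M _ HM] := h e e0.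
  by exists M => n Mn; rewrite distrC; exact: HM.
move=> h; apply/cvgrPdist_lt => e e0; have [M HM] := h e e0.
by exists M => // n Mn; rewrite distrC; exact: HM.
Qed.

Lemma cvgn_le (u v : nat -> R) (l : R) : v @ \oo --> (0 : R) ->
  (forall n, `|u n - l| <= v n) -> u @ \oo --> l.
Proof.
move=> /cvgn_epsP h uv; apply/cvgn_epsP => e /h[M HM]; exists M => n /HM.
by rewrite subr0 => /(le_lt_trans (ler_norm _)); exact: le_lt_trans.
Qed.

Lemma cvgn_ub (u : nat -> R) (l k : R) : u @ \oo --> l -> (forall n, u n <= k) -> l <= k.
Proof.
move=> /cvgn_epsP h uk; rewrite leNgt; apply/negP => kl.
have [|M HM] := h (l - k); first by rewrite subr_gt0.
have := HM _ (leqnn M); rewrite ltr_norml => /andP[+ _]; have := uk M; lra.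
Qed.

Definition has_ps a f :=
  forall p, Dp p -> (fun N => cmod (f p - PS a N p)) @ \oo --> (0 : R).

Lemma PS_lin a b (c : R[i]) N p :
  PS (fun n => a n + c * b n) N p = PS a N p + c * PS b N p.
Proof.
rewrite /PS mulr_sumr -big_split /=; apply: eq_bigr => i _; ring.
Qed.

Lemma has_ps_lin a b f g (c : R[i]) : has_ps a f -> has_ps b g ->
  has_ps (fun n => a n + c * b n) (fun p => f p + c * g p).
Proof.
move=> af bg p Dpp.
apply: (@cvgn_le _ (fun N => cmod (f p - PS a N p) + cmod c * cmod (g p - PS b N p))).
  rewrite -(addr0 (0 : R)); apply: cvgD; first exact: af.
  by rewrite -(mulr0 (cmod c)); apply: cvgM; [exact: cvg_cst|exact: bg].
move=> N; rewrite subr0 ger0_norm ?cmod_ge0// PS_lin -cmodM.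
by apply: le_trans (cmodD _ _); rewrite le_eqVlt; apply/orP; left; apply/eqP; congr cmod; ring.
Qed.

Lemma eqD_has_ps a f g : eqD f g -> has_ps a f -> has_ps a g.
Proof. by move=> fg af p Dpp; rewrite -fg//; exact: af. Qed.

Lemma A2_lin f g (c : R[i]) : A2 f -> A2 g -> A2 (fun p => f p + c * g p).
Proof.
move=> [Lf [a af]] [Lg [b bg]]; split; first exact: L2_lin.
by exists (fun n => a n + c * b n); exact: (has_ps_lin _ af bg).
Qed.

Lemma eqD_A2 f g : eqD f g -> A2 f -> A2 g.
Proof.
move=> fg [Lf [a af]]; split; first exact: eqD_L2 Lf.
by exists a; exact: eqD_has_ps af.
Qed.

Lemma A2_poly (P : {poly R[i]}) : A2 (fun p => P.[zc p]).
Proof.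
have E p : P.[zc p] = PS (fun n => P`_n) (size P) p by rewrite horner_coef.
split; first by under eq_fun do rewrite E; exact: L2_PS.
exists (fun n => P`_n) => p Dpp; apply/cvgn_epsP => e e0; exists (size P) => N sN.
have -> : \sum_(n < N) P`_n * zc p ^+ n = P.[zc p]; last first.
  by rewrite subrr cmod0 subr0 normr0.
rewrite horner_coef (big_ord_widen_cond N predT (fun i => P`_i * zc p ^+ i) sN).
rewrite [RHS]big_mkcond /=; apply: eq_bigr => i _; case: ifPn => //.
by rewrite -leqNgt => /(nth_default 0) ->; rewrite mul0r.
Qed.

Lemma A2_cst (c : R[i]) : A2 (fun=> c).
Proof. by apply: eqD_A2 (A2_poly c%:P) => p _; rewrite hornerC. Qed.

Lemma A2_scale f (c : R[i]) : A2 f -> A2 (fun p => c * f p).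
Proof. by move=> Af; apply: eqD_A2 (A2_lin c (A2_cst 0) Af) => p _; rewrite add0r. Qed.

Lemma A2_add f g : A2 f -> A2 g -> A2 (fun p => f p + g p).
Proof. by move=> Af Ag; apply: eqD_A2 (A2_lin 1 Af Ag) => p _; rewrite mul1r. Qed.

Lemma A2_sub f g : A2 f -> A2 g -> A2 (fun p => f p - g p).
Proof. by move=> Af Ag; apply: eqD_A2 (A2_lin (-1) Af Ag) => p _; rewrite mulN1r. Qed.

Lemma A2_L2 f : A2 f -> L2 f. Proof. by case. Qed.

Lemma geom_sum_le (q : R) n : 0 <= q < 1 -> \sum_(i < n) q ^+ i <= (1 - q)^-1.
Proof.
move=> /andP[q0 q1]; rewrite -[leRHS]mul1r ler_pdivlMr ?subr_gt0//.
have -> : (\sum_(i < n) q ^+ i) * (1 - q) = 1 - q ^+ n.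
  elim: n => [|n IH]; first by rewrite big_ord0 mul0r expr0 subrr.
  by rewrite big_ord_recr /= mulrDl IH exprS; ring.
by rewrite gerBl exprn_ge0.
Qed.

(** At the point s of the disc the remainders of the series converge, hence are bounded, and a_n s^n
    is the difference of two consecutive remainders. *)
Lemma coef_bounded a f (s : R) : has_ps a f -> 0 <= s < 1 ->
  exists2 K, 0 <= K & forall n, cmod (a n) * s ^+ n <= K.
Proof.
move=> af /andP[s0 s1].

have Ds : Dp (s, 0) by rewrite DpE /rdisc /r2 /= expr0n addr0 expr_lt1.
have zs : zc (s, 0) = (s%:C)%C by [].
pose e N := cmod (f (s, 0) - PS a N (s, 0)).
have [M [_ HM]] : bounded_fun e := cvg_seq_bounded (cvgP _ (af _ Ds)).
have eM n : e n <= M + 1 by apply: le_trans (ler_norm _) (HM (M + 1) _ n _) => //; rewrite ltrDl.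
exists (2 * (M + 1)).
  by have := eM 0%N; have := cmod_ge0 (f (s, 0) - PS a 0 (s, 0)); rewrite /e; lra.
move=> n; rewrite -{1}(ger0_norm s0).
have -> : cmod (a n) * `|s| ^+ n = cmod (a n * zc (s, 0) ^+ n).
  by rewrite cmodM cmodX zs cmodr// ger0_norm.
have -> : a n * zc (s, 0) ^+ n = (f (s, 0) - PS a n (s, 0)) + - (f (s, 0) - PS a n.+1 (s, 0)).
  by rewrite {2}/PS big_ord_recr /= -/(PS a n _); ring.
apply: le_trans (cmodD _ _) _; rewrite cmodN.
by have := eM n; have := eM n.+1; rewrite /e; lra.
Qed.

(** Majoration by a geometric series: |a_n| r^n <= K (r/s)^n. *)
Lemma PS_bound a (s r K : R) p N : 0 <= K -> (forall n, cmod (a n) * s ^+ n <= K) ->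
  0 < s -> r < s -> cmod (zc p) <= r -> cmod (PS a N p) <= K / (1 - r / s).
Proof.
move=> K0 aK s0 rs zr; have r0 : 0 <= r := le_trans (cmod_ge0 _) zr.
apply: le_trans (cmod_sum _ (fun n => a n * zc p ^+ n)) _.
apply: (@le_trans _ _ (\sum_(n < N) K * (r / s) ^+ n)).
  apply: ler_sum => n _; rewrite cmodM cmodX.
  apply: (@le_trans _ _ (cmod (a n) * r ^+ n)).
    by rewrite ler_wpM2l ?cmod_ge0// lerXn2r// nnegrE cmod_ge0.
  rewrite expr_div_n mulrA ler_pdivlMr ?exprn_gt0//.
  by rewrite mulrAC ler_wpM2r ?exprn_ge0.
rewrite -mulr_sumr ler_wpM2l// geom_sum_le// divr_ge0 ?(ltW s0)//=.
by rewrite ltr_pdivrMr// mul1r.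
Qed.

Lemma cmod_dist (x y : R[i]) : `|cmod x - cmod y| <= cmod (x - y).
Proof.
rewrite ler_norml; have := cmodD (x - y) y; have := cmodD (y - x) x.
by rewrite !subrK -(cmodN (x - y)) opprB => h1 h2; apply/andP; split; lra.
Qed.

Lemma cvg_n2_PS a f p : has_ps a f -> Dp p ->
  (fun N => n2 (PS a N p)) @ \oo --> n2 (f p).
Proof.
move=> af Dpp; under eq_fun do rewrite -cmod_sqr expr2.
have h : (fun N => cmod (PS a N p)) @ \oo --> cmod (f p).
  apply: cvgn_le (af _ Dpp) _ => N; rewrite distrC; exact: cmod_dist.
by rewrite -cmod_sqr expr2; exact: cvgM.
Qed.

(** Dominated convergence with a constant majorant. The bound c < 1 is what makes the partial sums
    uniformly bounded on A; on the whole disc they need not be. *)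
Lemma cvg_integral_PS a f A c : has_ps a f -> measC f -> measurable A ->
  c < 1 -> A `<=` rdisc c ->
  (fun N => Rintegral mu A (fun p => n2 (PS a N p))) @ \oo -->
    Rintegral mu A (fun p => n2 (f p)).
Proof.
move=> af mf mA c1 Ac.
have AD : A `<=` Dp by move=> p /Ac; rewrite /rdisc /= => h; exact: lt_trans h c1.
(* The square root appears because [rdisc c] bounds |z|^2, and the maximum with 0 covers negative c.
   Coefficients are estimated at s, halfway between r and 1, to gain the ratio r/s < 1. *)
pose r := Num.sqrt (Num.max c 0).
have r0 : 0 <= r by exact: sqrtr_ge0.
have r1 : r < 1.
  by rewrite -sqrtr1 ltr_sqrt// gt_max c1 ltr01.
pose s := (1 + r) / 2.
have s01 : 0 <= s < 1 by rewrite /s; apply/andP; split; lra.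
have [K K0 aK] := coef_bounded af s01.
have zr p : A p -> cmod (zc p) <= r.
  move=> /Ac h; rewrite /cmod ler_wsqrtr// -[leLHS]/(r2 p) le_max.
  by rewrite (ltW h).
pose M := K / (1 - r / s).
have bM N p : A p -> n2 (PS a N p) <= M ^+ 2.
  move=> Ap; apply: n2_le_sqr; apply: PS_bound => //; try (by rewrite /s; lra).
  exact: zr.
have mPS N : mfun A (fun p => n2 (PS a N p)).
  by apply: measurable_funS (measC_n2 (L2_measC (L2_PS a N))) => //; exact: measurable_Dp.
have ic : ig A (fun=> M ^+ 2).
  apply: (@ig_bounded _ _ _ (M ^+ 2)) => //.
  by move=> p _; rewrite ger0_norm// sqr_ge0.
have h := @dominated_cvg _ _ R mu A mA (fun N p => (n2 (PS a N p))%:E)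
  (fun p => (n2 (f p))%:E) (fun=> (M ^+ 2)%:E).
have {}h : (\int[mu]_(x in A) (n2 (PS a n x))%:E @[n --> \oo] --> \int[mu]_(x in A) (n2 (f x))%:E)%E.
  apply: h => //.
  - by move=> N; exact/measurable_EFinP.
  - move=> p Ap; apply: cvg_EFin; first by near=> N.
    exact: cvg_n2_PS af (AD _ Ap).
  - by move=> N p Ap; rewrite /= lee_fin ger0_norm ?n2_ge0// bM.
apply: fine_cvg; rewrite fineK//.
apply: integrable_fin_num => //.
apply: (@ig_le _ _ _ (fun=> M ^+ 2)) => //.
  by apply: measurable_funS (measC_n2 mf) => //; exact: measurable_Dp.
move=> p Ap; rewrite ger0_norm ?n2_ge0//.
by apply: cvgn_ub (cvg_n2_PS af (AD _ Ap)) _ => N; exact: bM.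
Unshelve. all: by end_near.
Qed.

End Analytic.

(** * Coefficient bounds and norm comparison by Parseval's identity on annuli *)

Section Complete.
Variable R : realType.
Local Notation mu := (@area R).
Local Notation RR := (measurableTypeR R * measurableTypeR R)%type.
Local Notation mfun A f := (@measurable_fun _ _ RR R A f).
Local Notation Dp := (@Dp R).
Local Notation zc := (@zc R).
Local Notation r2 := (@r2 R).
Local Notation ann := (@ann R).
Local Notation ig A F := (mu.-integrable (A : set RR) (EFin \o (F : RR -> R))).
Implicit Types (f g h : fn R) (a b : nat -> R[i]) (A : set RR).

Lemma ann_rdisc c d : ann c d `<=` rdisc d.
Proof. by move=> p /andP[]. Qed.

Lemma continuous_r2 : continuous (r2 : (R * R)%type -> R).
Proof.
move=> p; rewrite /r2; under eq_fun do rewrite !expr2.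
by apply: cvgD; apply: cvgM; solve [exact: cvg_fst|exact: cvg_snd].
Qed.

Lemma mu_ann_gt0 c d : 0 <= c < d -> d <= 1 -> 0 < fine (mu (ann c d)).
Proof.
move=> /andP[c0 cd] d1.
have mA := @measurable_ann R c d.
rewrite fine_gt0//; apply/andP; split; last first.
  by apply: mu_sub_Dp => //; exact: ann_Dp.
apply: (@mu_nbhs_gt0 _ _ (Num.sqrt ((c + d) / 2), 0)) => //.
apply: (@filterS _ _ _ (r2 @^-1` `]c, d[%classic)).
  by move=> q; rewrite /= in_itv /= /ann /= => /andP[/ltW -> ->].
apply: continuous_r2; apply: near_in_itvoo.
by rewrite in_itv /= /r2 /= expr0n addr0 sqr_sqrtr; [apply/andP; split|]; lra.
Qed.

Lemma mfun_r2X A k : mfun A (fun p => r2 p ^+ k).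
Proof. by apply: measurable_funTS; apply: measurable_funX; exact: measurable_r2. Qed.

Lemma ig_r2X c d k : d <= 1 -> ig (ann c d) (fun p => r2 p ^+ k).
Proof.
move=> d1; apply: (@ig_bounded _ _ _ 1).
- exact: measurable_ann.
- exact: ann_Dp.
- exact: mfun_r2X.
- move=> p Ap; rewrite ger0_norm ?exprn_ge0 ?r2_ge0// exprn_ile1 ?r2_ge0//.
  by apply/ltW; exact: (ann_Dp d1 Ap).
Qed.

Lemma ig_cst c d (k : R) : d <= 1 -> ig (ann c d) (fun=> k).
Proof.
move=> d1; apply: (@ig_bounded _ _ _ `|k|) => //.
- exact: measurable_ann.
- exact: ann_Dp.
Qed.

Lemma wgt_ge c d k : 0 <= c -> d <= 1 -> c ^+ k * fine (mu (ann c d)) <= wgt (ann c d) k.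
Proof.
move=> c0 d1; have mA := @measurable_ann R c d.
rewrite -Rintegral_cst//; apply: le_Rintegral => //; [exact: ig_cst|exact: ig_r2X|].
by move=> p /andP[cp _]; rewrite lerXn2r// nnegrE r2_ge0.
Qed.

Lemma wgt_le c d k : d <= 1 -> wgt (ann c d) k <= d ^+ k * fine (mu (ann c d)).
Proof.
move=> d1; have mA := @measurable_ann R c d.
rewrite -Rintegral_cst//; apply: le_Rintegral => //; [exact: ig_r2X|exact: ig_cst|].
move=> p /andP[_ pd]; have := r2_ge0 p => p0.
by rewrite lerXn2r ?nnegrE ?(ltW pd)// (le_trans p0 (ltW pd)).
Qed.

Lemma Rintegral_subset A f : measurable A -> A `<=` Dp -> L2 f ->
  Rintegral mu A (fun p => n2 (f p)) <= nrm f.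
Proof.
move=> mA AD Lf; rewrite nrmE /Rintegral; apply: fine_le.
- by apply: integrable_fin_num => //; apply: ig_sub => //; exact: L2_ign2.
- by apply: integrable_fin_num => //; [exact: measurable_Dp|exact: L2_ign2].
apply: ge0_subset_integral => //.
- exact: measurable_Dp.
- by apply/measurable_EFinP; apply: measC_n2; exact: L2_measC.
- by move=> p _; rewrite lee_fin n2_ge0.
Qed.

Lemma cvgn_lb (u : nat -> R) (l k : R) M : u @ \oo --> l ->
  (forall n, (M <= n)%N -> k <= u n) -> k <= l.
Proof.
move=> ul uk; apply: (ler_cvg_to (cvg_cst k) ul).
by exists M => // n /= Mn; exact: uk.
Qed.

Lemma cvgn_scale_le (u v : nat -> R) (l m k : R) : u @ \oo --> l -> v @ \oo --> m ->
  (forall n, u n <= k * v n) -> l <= k * m.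
Proof.
move=> ul vm uv; have h : (fun n => k * v n) @ \oo --> k * m by apply: cvgM => //; exact: cvg_cst.
by apply: (ler_cvg_to ul h); apply: nearW => n; exact: uv.
Qed.

Lemma wgt_ge0 A k : 0 <= wgt A k.
Proof. by apply: Rintegral_ge0 => p _; rewrite exprn_ge0// r2_ge0. Qed.

(** On the annulus c <= |z|^2 < d a single Parseval term is at most the whole sum, and its weight is
    at least c^k times the area. The outer bound d = (1 + c)/2 stays below 1 so that Parseval's
    identity passes from partial sums to f. *)
Lemma coef_bound c : 0 <= c < 1 -> exists2 K, 0 <= K &
  forall a f k, has_ps a f -> L2 f -> n2 (a k) * c ^+ k <= K * nrm f.
Proof.
move=> /andP[c0 c1]; pose d := (1 + c) / 2.
have d1 : d <= 1 by rewrite /d; lra.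
have m0 : 0 < fine (mu (ann c d)) by apply: mu_ann_gt0 => //; apply/andP; split; rewrite /d; lra.
exists (fine (mu (ann c d)))^-1; first by rewrite invr_ge0 ltW.
move=> a f k af Lf; rewrite [leRHS]mulrC ler_pdivlMr//.
have mA := @measurable_ann R c d.
have AD : ann c d `<=` Dp by exact: ann_Dp.
apply: le_trans (Rintegral_subset mA AD Lf).
have cv := @cvg_integral_PS R a f (ann c d) d af (L2_measC Lf) mA _ _.
(* The k-th term occurs in [PS a n] only when k < n. *)
apply: (cvgn_lb (M := k.+1) (cv _ _)).
- by rewrite /d; lra.
- by move=> p /andP[].
move=> n kn; rewrite parseval_PS//; last exact: rot_ann.
rewrite (bigD1 (Ordinal kn))//= -[leLHS]addr0 lerD//; last first.
  by apply: sumr_ge0 => i _; rewrite mulr_ge0 ?n2_ge0 ?wgt_ge0.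
by rewrite -mulrA ler_wpM2l ?n2_ge0// wgt_ge.
Qed.

(** The weight of z^n is at most c^n |C| on the inner disc C = [ann 0 c], and at least c^n |A| on A
    = [ann c d]. The powers cancel, so the ratio |C| / |A| bounds the Parseval sums term by term,
    independently of n and f. The summand 1 in K + 1 accounts for the annulus itself. *)
Lemma annulus_bound c : 0 < c < 1 -> exists2 K, 0 < K &
  forall f, A2 f -> nrm f <= K * Rintegral mu (ann c 1) (fun p => n2 (f p)).
Proof.
move=> /andP[c0 c1]; pose d := (1 + c) / 2.
have d1 : d <= 1 by rewrite /d; lra.
have d1' : d < 1 by rewrite /d; lra.
have mA := @measurable_ann R c d.
have mC := @measurable_ann R 0 c.
have mE := @measurable_ann R c 1.
have AD : ann c d `<=` Dp by exact: ann_Dp.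
have CD : ann 0 c `<=` Dp by apply: ann_Dp; exact: ltW.
have ED : ann c 1 `<=` Dp by exact: ann_Dp.
have m0 : 0 < fine (mu (ann c d)).
  by apply: mu_ann_gt0 => //; apply/andP; split; rewrite /d; lra.
pose K := fine (mu (ann 0 c)) / fine (mu (ann c d)).
have K0 : 0 <= K by rewrite divr_ge0 ?fine_ge0.
exists (K + 1); first by lra.
move=> f [Lf [a af]].
have igf := L2_ign2 Lf.
have le1 : Rintegral mu (ann 0 c) (fun p => n2 (f p)) <=
           K * Rintegral mu (ann c d) (fun p => n2 (f p)).
  have u1 := @cvg_integral_PS R a f _ c af (L2_measC Lf) mC c1 (@ann_rdisc 0 c).
  have u2 := @cvg_integral_PS R a f _ d af (L2_measC Lf) mA d1' (@ann_rdisc c d).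
  apply: (cvgn_scale_le u1 u2) => n.
  rewrite [leLHS]parseval_PS//; last exact: rot_ann.
  rewrite [X in _ <= K * X]parseval_PS//; last exact: rot_ann.
  rewrite mulr_sumr; apply: ler_sum => i _; rewrite mulrCA ler_wpM2l ?n2_ge0//.
  apply: le_trans (wgt_le _ _ (ltW c1)) _.
  rewrite /K mulrAC ler_pdivlMr// mulrAC mulrC ler_wpM2l ?fine_ge0//.
  exact: wgt_ge (ltW c0) d1.
have le2 : Rintegral mu (ann c d) (fun p => n2 (f p)) <=
           Rintegral mu (ann c 1) (fun p => n2 (f p)).
  rewrite /Rintegral; apply: fine_le.
  - by apply: integrable_fin_num => //; apply: ig_sub.
  - by apply: integrable_fin_num => //; apply: ig_sub.
  apply: ge0_subset_integral => //.
  - apply/measurable_EFinP; apply: measurable_funS (measC_n2 (L2_measC Lf)) => //.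
    exact: measurable_Dp.
  - by move=> p _; rewrite lee_fin n2_ge0.
  - by move=> p /andP[h1 h2]; rewrite /ann /= h1 (lt_le_trans h2).
have -> : nrm f = Rintegral mu (ann 0 c) (fun p => n2 (f p)) +
   Rintegral mu (ann c 1) (fun p => n2 (f p)).
  have U : ann 0 c `|` ann c 1 = Dp.
    apply/seteqP; split => p; first by case=> [/CD|/ED].
    rewrite DpE /rdisc /ann /= => p1; case: (ltP (r2 p) c) => pc.
      by left; rewrite r2_ge0.
    by right; rewrite p1.
  rewrite nrmE -U Rintegral_setU// ?U//.
  apply/eqP; rewrite predeqE => p; split => //.
  by case=> /andP[_ h1] /andP[h2 _]; have := lt_le_trans h1 h2; rewrite ltxx.
by rewrite mulrDl mul1r lerD2r; apply: le_trans le1 _; rewrite ler_wpM2l.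
Qed.

End Complete.

(** * Bounded point evaluations and completeness of the Bergman space *)

Section Completeness.
Variable R : realType.
Local Notation mu := (@area R).
Local Notation RR := (measurableTypeR R * measurableTypeR R)%type.
Local Notation mfun A f := (@measurable_fun _ _ RR R A f).
Local Notation Dp := (@Dp R).
Local Notation zc := (@zc R).
Local Notation r2 := (@r2 R).
Implicit Types (f g h : fn R) (a b : nat -> R[i]).

Lemma coef_boundN (s : R) : 0 <= s < 1 -> exists2 K, 0 <= K &
  forall a f k, has_ps a f -> L2 f -> cmod (a k) * s ^+ k <= K * N f.
Proof.
move=> /andP[s0 s1].
have s2 : 0 <= s ^+ 2 < 1 by rewrite sqr_ge0 expr_lt1.
have [K K0 HK] := coef_bound s2.
exists (Num.sqrt K); first exact: sqrtr_ge0.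
move=> a f k af Lf; rewrite -(@ler_pXn2r _ 2)// ?nnegrE.
- rewrite !exprMn cmod_sqr sqr_sqrtr// N_sqr exprAC; exact: HK.
- by rewrite mulr_ge0 ?cmod_ge0 ?exprn_ge0.
- by rewrite mulr_ge0 ?sqrtr_ge0 ?N_ge0.
Qed.

(** The coefficient bound at a radius s > |z| is summed by [PS_bound]. The bound on partial sums,
    uniform in their length, is kept because it is what makes a limit of analytic functions
    analytic. *)
Lemma eval_bound p : Dp p -> exists2 K, 0 <= K & forall a f, has_ps a f -> L2 f ->
  (forall n, cmod (PS a n p) <= K * N f) /\ cmod (f p) <= K * N f.
Proof.
move=> Dpp; pose r := cmod (zc p).
have r0 : 0 <= r := cmod_ge0 _.
have r1 : r < 1 by rewrite -sqrtr1 ltr_sqrt.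
pose s := (1 + r) / 2.
have s01 : 0 <= s < 1 by apply/andP; split; rewrite /s; lra.
have [K K0 HK] := coef_boundN s01.
have q0 : 0 <= (1 - r / s)^-1.
  by rewrite invr_ge0 subr_ge0 ler_pdivrMr ?mul1r; rewrite /s; lra.
exists (K / (1 - r / s)); first by rewrite mulr_ge0.
move=> a f af Lf.
have h n : cmod (PS a n p) <= K / (1 - r / s) * N f.
  rewrite mulrAC; apply: PS_bound => //; try (by rewrite /s; lra).
  - by rewrite mulr_ge0 ?N_ge0.
  - by move=> k; exact: HK.
split=> //; apply: cvgn_ub (h) => //=.
by apply: cvgn_le (af _ Dpp) _ => n; rewrite distrC; exact: cmod_dist.
Qed.

Lemma A2_N0 f : A2 f -> N f = 0 -> eqD f (fun=> 0).
Proof.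
move=> [Lf [a af]] f0 p Dpp; have [K _ HK] := eval_bound Dpp.
have [_] := HK a f af Lf; rewrite f0 mulr0 => h; apply: cmod_eq0.
by apply/eqP; rewrite eq_le h cmod_ge0.
Qed.

Lemma real_cauchy (x : nat -> R) (e : nat -> R) : e @ \oo --> (0 : R) ->
  (forall n m, (n <= m)%N -> `|x m - x n| <= e n) ->
  exists l, forall n, `|x n - l| <= e n.
Proof.
move=> e0 xe.
have cx : cvgn x.
  apply: cauchy_cvg; apply: cauchy_exP => _/posnumP[d].
  have [M HM] := (cvgn_epsP _ _).1 e0 d%:num (gt0 _).
  exists (x M); exists M => // n /= Mn; rewrite /ball /= distrC.
  apply: le_lt_trans (xe _ _ Mn) _; have := HM _ (leqnn M).
  by rewrite subr0; apply: le_lt_trans; exact: ler_norm.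
exists (limn x) => n.
have h : (fun m => `|x n - x (m + n)%N|) @ \oo --> `|x n - limn x|.
  apply: cvg_norm; apply: cvgB; first exact: cvg_cst.
  by rewrite (cvg_shiftn n x).
by apply: cvgn_ub h _ => m; rewrite distrC; apply: xe; exact: leq_addl.
Qed.

Lemma complex_cauchy (x : nat -> R[i]) (e : nat -> R) : e @ \oo --> (0 : R) ->
  (forall n m, (n <= m)%N -> cmod (x m - x n) <= e n) ->
  exists l, forall n, cmod (x n - l) <= 2 * e n.
Proof.
move=> e0 xe.
have [|l1 h1] := @real_cauchy (fun n => ReC (x n)) e e0.
  by move=> n m nm; rewrite -ReCN -ReCD; apply: le_trans (normr_ReC _) (xe _ _ nm).
have [|l2 h2] := @real_cauchy (fun n => ImC (x n)) e e0.
  by move=> n m nm; rewrite -ImCN -ImCD; apply: le_trans (normr_ImC _) (xe _ _ nm).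
exists (l1 +i* l2)%C => n; apply: le_trans (cmod_le_ReIm _) _.
rewrite !cE -[ReC (_ +i* _)%C]/l1 -[ImC (_ +i* _)%C]/l2.
by have := h1 n; have := h2 n; lra.
Qed.

Lemma cvgn_sqrt0 (e : nat -> R) : e @ \oo --> (0 : R) ->
  (fun n => Num.sqrt (e n)) @ \oo --> (0 : R).
Proof.
move=> /cvgn_epsP h; apply/cvgn_epsP => d d0.
have [|M HM] := h (d ^+ 2); first by rewrite exprn_gt0.
exists M => n /HM; rewrite !subr0 => h1; rewrite ger0_norm ?sqrtr_ge0//.
rewrite -[ltRHS]ger0_norm ?(ltW d0)// -sqrtr_sqr ltr_sqrt ?exprn_gt0//.
by apply: le_lt_trans h1; exact: ler_norm.
Qed.

Lemma cvgn_scale0 (e : nat -> R) k : e @ \oo --> (0 : R) ->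
  (fun n => k * e n) @ \oo --> (0 : R).
Proof.
by move=> e0; rewrite -(mulr0 k); apply: cvgM => //; exact: cvg_cst.
Qed.

Lemma limn_einf_ub (u : nat -> \bar R) k : (forall n, (u n <= k)%E) -> (limn_einf u <= k)%E.
Proof.
move=> uk; rewrite limn_einf_lim; apply: lime_le; first exact: is_cvg_einfs.
apply: nearW => n; apply: le_trans (uk n).
by apply: ereal_inf_lbound; exists n => //=.
Qed.

(** Values and Taylor coefficients both converge, by boundedness of evaluations and of coefficient
    functionals; the limit coefficients form a power series of the pointwise limit, and Fatou's
    lemma gives the rate in norm. *)
Lemma A2_complete (u : nat -> fn R) (eps : nat -> R) : (forall n, A2 (u n)) ->
  eps @ \oo --> (0 : R) ->
  (forall n m, (n <= m)%N -> nrm (fun p => u m p - u n p) <= eps n) ->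
  exists2 g, A2 g & forall n, nrm (fun p => u n p - g p) <= eps n.
Proof.
move=> Au eps0 ue.
have Lu n : L2 (u n) := A2_L2 (Au n).
have /choice[a Ha] : forall n, exists a, has_ps a (u n).
  by move=> n; have [_ [a Ha]] := Au n; exists a.
pose se n := Num.sqrt (eps n).
have se0 : se @ \oo --> (0 : R) by exact: cvgn_sqrt0.
have Nue n m : (n <= m)%N -> N (fun p => u m p - u n p) <= se n.
  by move=> nm; rewrite ler_wsqrtr// ue.
have had n m : has_ps (fun k => a m k - a n k) (fun p => u m p - u n p).
  have h := has_ps_lin (-1) (Ha m) (Ha n).
  have -> : (fun k => a m k - a n k) = (fun k => a m k + -1 * a n k).
    by apply/funext => k; rewrite mulN1r.
  by apply: eqD_has_ps h => p _; rewrite mulN1r.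
have Ldiff n m : L2 (fun p => u m p - u n p) by exact: L2_sub.
(* The pair holds the limit value at p and the evaluation constant at p; outside the disc it takes
   the default value (0, 0). *)
have /choice[gK HgK] : forall p, exists lK : R[i] * R, Dp p -> [/\ 0 <= lK.2,
    (forall n, cmod (u n p - lK.1) <= 2 * (lK.2 * se n)) &
    forall n m k, (n <= m)%N -> cmod (PS (fun k => a m k - a n k) k p) <= lK.2 * se n].
  move=> p; have [Dpp|nD] := pselect (Dp p); last by exists (0, 0).
  have [K K0 HK] := eval_bound Dpp.
  have [|n m nm|l Hl] := @complex_cauchy (fun n => u n p) (fun n => K * se n).
  - exact: cvgn_scale0.
  - have [_ h] := HK _ _ (had n m) (Ldiff n m).
    by apply: le_trans h _; rewrite ler_wpM2l// Nue.
  exists (l, K) => _; split => // n m k nm.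
  have [h _] := HK _ _ (had n m) (Ldiff n m).
  by apply: le_trans (h k) _; rewrite ler_wpM2l// Nue.
(* The rate of convergence of the k-th coefficient depends on k; the radius 1/2 is an arbitrary
   choice in (0, 1). *)
have /choice[bK HbK] : forall k, exists lK : R[i] * R,
    forall n, cmod (a n k - lK.1) <= lK.2 * se n.
  move=> k; have hs : 0 <= (1 / 2 : R) < 1 by apply/andP; split; lra.
  have [K K0 HK] := coef_boundN hs.
  have pk : 0 < (1 / 2 : R) ^+ k by rewrite exprn_gt0// divr_gt0.
  have [|n m nm|l Hl] := @complex_cauchy (fun n => a n k) (fun n => K / (1 / 2) ^+ k * se n).
  - exact: cvgn_scale0.
  - rewrite mulrAC ler_pdivlMr//; apply: le_trans (HK _ _ k (had n m) (Ldiff n m)) _.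
    by rewrite ler_wpM2l// Nue.
  by exists (l, 2 * (K / (1 / 2) ^+ k)) => n; rewrite -mulrA; exact: Hl.
pose g p := (gK p).1; pose b k := (bK k).1.
have ug p n : Dp p -> cmod (u n p - g p) <= 2 * ((gK p).2 * se n).
  by move=> Dpp; have [_ h _] := HgK p Dpp; exact: h.
have ugc p : Dp p -> (fun n => cmod (u n p - g p)) @ \oo --> (0 : R).
  move=> Dpp; apply: (@cvgn_le _ _ (fun n => 2 * ((gK p).2 * se n))).
    by apply: cvgn_scale0; exact: cvgn_scale0.
  by move=> n; rewrite subr0 ger0_norm ?cmod_ge0// ug.
(* This bound is uniform in k. Compare with a later index m, for which the evaluation bound is
   uniform in k, then let m tend to infinity with k fixed, so that [S * se m] disappears. The
   uniformity allows the limits in n and k to be exchanged in [hg]. *)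
have PSb p n k : Dp p -> cmod (PS (a n) k p - PS b k p) <= (gK p).2 * se n.
  move=> Dpp; have [_ _ h] := HgK p Dpp.
  pose S := \sum_(i < k) (bK i).2.
  have hm m : (n <= m)%N -> cmod (PS (a n) k p - PS b k p) <= (gK p).2 * se n + S * se m.
    move=> nm.
    have -> : PS (a n) k p - PS b k p =
        - PS (fun i => a m i - a n i) k p + PS (fun i => a m i - b i) k p.
      rewrite /PS -[LHS]sumrB -[X in _ = X + _]sumrN -big_split /=; apply: eq_bigr => i _; ring.
    apply: le_trans (cmodD _ _) _; rewrite cmodN lerD ?h//.
    apply: le_trans (cmod_sum _ (fun i => (a m i - b i) * zc p ^+ i)) _.
    rewrite mulr_suml; apply: ler_sum => i _; rewrite cmodM cmodX.
    apply: le_trans (HbK i m); rewrite -[leRHS]mulr1 ler_wpM2l ?cmod_ge0//.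
    by rewrite exprn_ile1 ?cmod_ge0 ?cmod_zc_le1.
  have c1 : (fun m => (gK p).2 * se n + S * se m) @ \oo --> (gK p).2 * se n + 0.
    by apply: cvgD; [exact: cvg_cst|exact: cvgn_scale0].
  by rewrite -[leRHS]addr0; apply: (cvgn_lb (M := n) c1).
have hg : has_ps b g.
  move=> p Dpp; apply/cvgn_epsP => e e0.
  have e3 : 0 < e / 3 by lra.
  have c2 : (fun n => (gK p).2 * se n) @ \oo --> (0 : R) by exact: cvgn_scale0.
  have [M1 H1] := (cvgn_epsP _ _).1 (ugc p Dpp) _ e3.
  have [M2 H2] := (cvgn_epsP _ _).1 c2 _ e3.
  pose n := maxn M1 M2.
  have [M3 H3] := (cvgn_epsP _ _).1 (Ha n p Dpp) _ e3.
  exists M3 => k /H3; rewrite !subr0 !ger0_norm ?cmod_ge0// => h3.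
  have := H1 n (leq_maxl _ _); rewrite subr0 ger0_norm ?cmod_ge0// => h1.
  have := H2 n (leq_maxr _ _); rewrite subr0 => /(le_lt_trans (ler_norm _)) h2.
  have := PSb p n k Dpp => h4.
  have -> : g p - PS b k p =
      - (u n p - g p) + ((u n p - PS (a n) k p) + (PS (a n) k p - PS b k p)) by ring.
  apply: le_lt_trans (cmodD _ _) _; rewrite cmodN.
  have := cmodD (u n p - PS (a n) k p) (PS (a n) k p - PS b k p).
  by lra.
have mg : measC g.
  apply: measCP.
    apply: (@measurable_fun_cvg _ RR R Dp (fun n p => ReC (u n p))).
      by move=> n; exact: measC_Re (L2_measC (Lu n)).
    move=> p Dpp; apply: cvgn_le (ugc p Dpp) _ => n.
    by rewrite -ReCN -ReCD; exact: normr_ReC.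
  apply: (@measurable_fun_cvg _ RR R Dp (fun n p => ImC (u n p))).
    by move=> n; exact: measC_Im (L2_measC (Lu n)).
  move=> p Dpp; apply: cvgn_le (ugc p Dpp) _ => n.
  by rewrite -ImCN -ImCD; exact: normr_ImC.
have mug n : measC (fun p => u n p - g p).
  apply: measC_eqD (measCD (L2_measC (Lu n)) (measCM (measC_cst (-1)) mg)) => p _.
  by rewrite mulN1r.
(* Fatou's lemma along u (m + n) - u n; the shift makes the Cauchy hypothesis available for every
   m. *)
have intle n : (\int[mu]_(p in Dp) (n2 (u n p - g p))%:E <= (eps n)%:E)%E.
  have mD : measurable (Dp : set RR) by exact: measurable_Dp.
  pose F m (p : RR) := (n2 (u (m + n)%N p - u n p))%:E.
  have mF m : measurable_fun Dp (F m).
    by apply/measurable_EFinP; apply: measC_n2; exact/L2_measC/Ldiff.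
  have F0 m p : Dp p -> (0 <= F m p)%E by move=> _; rewrite lee_fin n2_ge0.
  have := @fatou _ _ R mu Dp mD F mF F0.
  rewrite (@eq_integral _ _ _ mu Dp (fun p => (n2 (u n p - g p))%:E)); last first.
    move=> p /set_mem Dpp.
    have -> : n2 (u n p - g p) = n2 (g p - u n p) by rewrite /n2 !cE; ring.
    have h : (fun m => cmod (u (m + n)%N p - u n p)) @ \oo --> cmod (g p - u n p).
      rewrite (cvg_shiftn n (fun m => cmod (u m p - u n p))).
      apply: cvgn_le (ugc p Dpp) _ => m; apply: le_trans (cmod_dist _ _) _.
      by rewrite le_eqVlt; apply/orP; left; apply/eqP; congr cmod; ring.
    have h2 : (fun m => n2 (u (m + n)%N p - u n p)) @ \oo --> n2 (g p - u n p).
      under eq_fun do rewrite -cmod_sqr expr2.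
      by rewrite -cmod_sqr expr2; exact: cvgM.
    by apply: (cvg_limn_einf_sup _).1; apply: cvg_EFin => //; exact: nearW.
  move=> h; apply: le_trans h _; apply: limn_einf_ub => m.
  have fin : (\int[mu]_(x in Dp) F m x)%E \is a fin_num.
    by apply: integrable_fin_num => //; exact: L2_ign2.
  rewrite -(fineK fin) lee_fin; have := ue n (m + n)%N (leq_addl _ _).
  by rewrite nrmE.
have Lug n : L2 (fun p => u n p - g p).
  split => //; apply: le_lt_trans (ltry (eps n)).
  apply: le_trans (intle n); rewrite le_eqVlt; apply/orP; left; apply/eqP.
  by apply: eq_integral => p _; rewrite cmod_sqr.
exists g.
  split; last by exists b.
  by apply: eqD_L2 (L2_sub (Lu 0%N) (Lug 0%N)) => p _; ring.
move=> n; rewrite nrmE -lee_fin fineK; first exact: intle.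
by apply: integrable_fin_num; [exact: measurable_Dp|exact: L2_ign2].
Qed.

End Completeness.

(** * Existence and characterization of the orthogonal projection *)

Section Projection.
Variable R : realType.
Local Notation Dp := (@Dp R).
Implicit Types (f g h u : fn R).

Lemma pi_neq0 : (pi : R) != 0. Proof. by rewrite gt_eqF// pi_gt0. Qed.

Lemma orthA2P u : orthA2 u <-> forall h, A2 h -> B u h = 0.
Proof.
split=> ou h Ah; last first.
  by rewrite ip_B !ou ?mulr0//; exact: A2_scale.
have := ou h Ah; rewrite ip_B => -[/eqP + _].
by rewrite mulf_eq0 invr_eq0 (negbTE pi_neq0) => /eqP.
Qed.

Lemma B_scale_adj f h (c : R[i]) : B (fun p => c * f p) h = B f (fun p => cconj c * h p).
Proof. by apply: eq_Rintegral => p _; rewrite /dotc !cE; ring. Qed.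

(** The first-variation argument: minimality of a distance yields this inequality for every t. The
    test value b / (k + 1), instead of the optimal b / k, also covers k = 0. *)
Lemma eq0_of_linear_le_quadratic (b k : R) : 0 <= k ->
  (forall t, 2 * t * b <= t ^+ 2 * k) -> b = 0.
Proof.
move=> k0 h; have := h (b / (k + 1)).
have k1 : 0 < k + 1 by lra.
rewrite -subr_ge0 (_ : _ - _ = - (b ^+ 2 * (k + 2) / (k + 1) ^+ 2)); last by field; lra.
rewrite oppr_ge0 pmulr_lle0 ?invr_gt0 ?exprn_gt0// pmulr_lle0; last by lra.
by move=> b0; apply/eqP; rewrite -sqrf_eq0 eq_le b0 sqr_ge0.
Qed.

Lemma projection_exists u : L2 u ->
  exists2 g, A2 g & forall h, A2 h -> B (fun p => u p - g p) h = 0.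
Proof.
move=> Lu.
pose S := [set nrm (fun p => u p - h p) | h in [set h | A2 h]].
have hS : has_inf S.
  split; first by exists (nrm (fun p => u p - 0)); exists (fun=> 0) => //; exact: A2_cst.
  by exists 0 => _ [h _ <-]; exact: nrm_ge0.
pose d := inf S; pose e n : R := n.+1%:R^-1.
have e_gt0 n : 0 < e n by rewrite invr_gt0.
have dmin h : A2 h -> d <= nrm (fun p => u p - h p).
  by move=> Ah; apply: ge_inf; [exact: hS.2|exists h].
have /choice[g Hg] : forall n, exists g, A2 g /\ nrm (fun p => u p - g p) < d + e n.
  by move=> n; have [_ [g Ag <-] lt] := inf_adherent (e_gt0 n) hS; exists g.
have Ag n : A2 (g n) := (Hg n).1.
have Lg n : L2 (g n) := A2_L2 (Ag n).
have Lug n : L2 (fun p => u p - g n p) by exact: L2_sub.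
have e0 : e @ \oo --> (0 : R) by exact: cvg_harmonic.
have ele n m : (n <= m)%N -> e m <= e n.
  by move=> nm; rewrite lef_pV2 ?posrE// ler_nat ltnS.
have ep0 : (fun n => 4 * e n) @ \oo --> (0 : R) by exact: cvgn_scale0.
(* parallelogram law *)
have gc n m : (n <= m)%N -> nrm (fun p => g m p - g n p) <= 4 * e n.
  move=> nm.
  have Am : A2 (fun p => ((1 / 2)%:C)%C * (g m p + g n p)) by apply/A2_scale/A2_add.
  have E1 : nrm (fun p => g m p - g n p) =
      nrm (fun p => (u p - g n p) - (u p - g m p)).
    by apply: eqD_nrm => p _; ring.
  have E2 : 4 * nrm (fun p => u p - ((1 / 2)%:C)%C * (g m p + g n p)) =
      nrm (fun p => (u p - g n p) + (u p - g m p)).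
    rewrite -[4](_ : n2 ((2 : R)%:C)%C = 4); last by rewrite /n2 !cE expr0n addr0; ring.
    rewrite -nrm_scale; last by apply: L2_sub => //; exact: A2_L2.
    apply: eqD_nrm => p _; rewrite mulrBr mulrA -rmorphM /= (_ : 2 * (1 / 2) = 1 :> R).
      by rewrite mul1r (_ : (2%:C)%C = 2 :> R[i]) ?rmorph_nat//; ring.
    by field.
  have := dmin _ Am; move: E1 E2; rewrite (nrm_sub (Lug n) (Lug m)) (nrm_add (Lug n) (Lug m)).
  have := (Hg n).2; have := (Hg m).2; have := ele n m nm; lra.
have [g0 Ag0 Hg0] := A2_complete Ag ep0 gc.
exists g0 => // h Ah; have Lh := A2_L2 Ah; have Lg0 := A2_L2 Ag0.
apply: (@eq0_of_linear_le_quadratic _ (nrm h)); first exact: nrm_ge0.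
move=> t.
(* Each g_n is minimal only up to [e n], and replacing g_n by its limit g0 costs the last summand;
   both errors vanish in the limit. *)
pose v n := e n + t ^+ 2 * nrm h + (2 * `|t| * N h) * Num.sqrt (4 * e n).
have vc : v @ \oo --> 0 + t ^+ 2 * nrm h + 0.
  apply: cvgD; first by apply: cvgD => //; exact: cvg_cst.
  by apply: cvgn_scale0; exact: cvgn_sqrt0.
rewrite -[leRHS]addr0 -[leRHS]add0r addrA.
apply: (cvgn_lb (M := 0) vc) => n _.
have h1 : 2 * t * B (fun p => u p - g n p) h <= e n + t ^+ 2 * nrm h.
  have A1 : A2 (fun p => g n p + (t%:C)%C * h p) by exact: A2_lin.
  have := dmin _ A1.
  rewrite (_ : nrm _ = nrm (fun p => (u p - g n p) + ((- t)%:C)%C * h p)); last first.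
    by apply: eqD_nrm => p _; rewrite rmorphN mulNr opprD addrA.
  rewrite nrm_lin// sqrrN; have := (Hg n).2; lra.
have h2 : `|B (fun p => u p - g0 p) h - B (fun p => u p - g n p) h| <=
    N h * Num.sqrt (4 * e n).
  rewrite -B_sub//; last exact: L2_sub.
  rewrite (eqD_B (f' := fun p => g n p - g0 p) (g' := h))// => [|p _]; last by ring.
  apply: le_trans (CauchySchwarz _ Lh) _; first exact: L2_sub.
  by rewrite mulrC ler_wpM2l ?N_ge0// ler_wsqrtr.
have h3 : 2 * t * (B (fun p => u p - g0 p) h - B (fun p => u p - g n p) h) <=
    (2 * `|t| * N h) * Num.sqrt (4 * e n).
  apply: le_trans (ler_norm _) _; rewrite normrM normrM [`|2|]ger0_norm// -!mulrA.
  by do 2 apply: ler_wpM2l => //.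
by rewrite /v; move: h1 h3; rewrite mulrBr; lra.
Qed.

(** Testing on h = f - g gives norm zero. Identities for Toeplitz operators are reduced in this way
    to identities for [B], where the projection disappears. *)
Lemma orthA2_unique f g : A2 f -> A2 g -> (forall h, A2 h -> B f h = B g h) -> eqD f g.
Proof.
move=> Af Ag fg p Dpp; have Ad := A2_sub Af Ag.
have : N (fun p => f p - g p) = 0.
  apply/eqP; rewrite sqrtr_eq0 /nrm B_sub; [|exact: A2_L2..].
  by rewrite fg// subrr.
by move=> /(A2_N0 Ad)/(_ p Dpp)/eqP; rewrite subr_eq0 => /eqP.
Qed.

(** Existence discharges the default value of [xget]; from here on the projection is handled only
    through these two properties. *)
Lemma PprojP u : L2 u -> A2 (Pproj u) /\ forall h, A2 h -> B (Pproj u) h = B u h.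
Proof.
move=> Lu; have [g Ag og] := projection_exists Lu.
have [|A1 /orthA2P o1] := @xgetPex _ (fun=> 0)
    [set g | A2 g /\ orthA2 (fun p => u p - g p)].
  by exists g; split => //; apply/orthA2P.
split=> // h Ah; apply/eqP; rewrite eq_sym -subr_eq0 -B_sub//.
- by rewrite o1.
- exact: A2_L2.
- exact: A2_L2.
Qed.

End Projection.

(** * Linearity and boundedness of Toeplitz operators with bounded symbol *)

Section ToeplitzOperator.
Variables (R : realType) (phi : fn R) (M : R).
Local Notation Dp := (@Dp R).
Hypotheses (mphi : measC phi) (phiM : forall p, Dp p -> cmod (phi p) <= M).
Implicit Types (f g h : fn R).
Local Notation T := (Toeplitz phi).

Lemma L2_Mul f : L2 f -> L2 (Mul phi f).
Proof. exact: L2_mul mphi phiM. Qed.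

Lemma A2_Toeplitz f : A2 f -> A2 (T f).
Proof. by move=> Af; have [] := PprojP (L2_Mul (A2_L2 Af)). Qed.

Lemma B_Toeplitz f h : A2 f -> A2 h -> B (T f) h = B (Mul phi f) h.
Proof. by move=> Af Ah; have [_] := PprojP (L2_Mul (A2_L2 Af)); exact. Qed.

Lemma Toeplitz_eqD f g : A2 f -> A2 g -> eqD f g -> eqD (T f) (T g).
Proof.
move=> Af Ag fg; apply: orthA2_unique; [exact: A2_Toeplitz..|] => h Ah.
by rewrite !B_Toeplitz//; apply: eqD_B => // p Dpp; rewrite /Mul fg.
Qed.

Lemma Toeplitz_lin f g (c : R[i]) : A2 f -> A2 g ->
  eqD (T (fun p => f p + c * g p)) (fun p => T f p + c * T g p).
Proof.
move=> Af Ag; have Al := A2_lin c Af Ag.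
apply: orthA2_unique; [exact: A2_Toeplitz| |].
  by apply: A2_lin; exact: A2_Toeplitz.
move=> h Ah; have Lh := A2_L2 Ah.
rewrite B_Toeplitz//.
have L1 : L2 (fun p => c * T g p) by apply/L2_scale/A2_L2/A2_Toeplitz.
rewrite [RHS]B_add//; last exact/A2_L2/A2_Toeplitz.
rewrite B_scale_adj !B_Toeplitz//; last exact: A2_scale.
rewrite -B_scale_adj -B_add//.
- by apply: eqD_B => // p _; rewrite /Mul; ring.
- exact/L2_Mul/A2_L2.
- exact/L2_scale/L2_Mul/A2_L2.
Qed.

Lemma N_Mul f : L2 f -> 0 <= M -> N (Mul phi f) <= M * N f.
Proof.
move=> Lf M0; rewrite -[M]ger0_norm// -sqrtr_sqr -sqrtrM ?sqr_ge0// ler_wsqrtr//.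
rewrite !nrmE -RintegralZl; [|exact: measurable_Dp|exact: L2_ign2].
apply: le_Rintegral; [exact: measurable_Dp|exact/L2_ign2/L2_Mul| |].
  by apply: igZ; [exact: L2_ign2|exact: measurable_Dp].
by move=> p Dpp; rewrite /Mul n2M ler_wpM2r ?n2_ge0//; exact/n2_le_sqr/phiM.
Qed.

(** Testing T f against itself gives |T f|^2 = B (phi f) (T f) <= M |f| |T f|; then one factor |T f|
    is cancelled. *)
Lemma N_Toeplitz f : A2 f -> 0 <= M -> N (T f) <= M * N f.
Proof.
move=> Af M0; have AT := A2_Toeplitz Af.
have h : N (T f) * N (T f) <= M * N f * N (T f).
  rewrite -expr2 N_sqr /nrm B_Toeplitz//; apply: le_trans (ler_norm _) _.
  apply: le_trans (CauchySchwarz _ _) _; [exact/L2_Mul/A2_L2|exact: A2_L2|].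
  by rewrite ler_wpM2r ?N_ge0// N_Mul//; exact: A2_L2.
have := N_ge0 (T f); rewrite le_eqVlt => /orP[/eqP <-|t0].
  by rewrite mulr_ge0 ?N_ge0.
by rewrite ler_pM2r in h.
Qed.

End ToeplitzOperator.

(** * A gliding hump for weakly null unit vectors *)

Section GlidingHump.
Variable R : realType.
Implicit Types (f g h : fn R).

Lemma cvg_geometric4 : (fun j => (1 / 4 : R) ^+ j) @ \oo --> (0 : R).
Proof. by apply: cvg_expr; rewrite ger0_norm; lra. Qed.

(* A uniform boundedness principle: the witness is the sum of 4^-j f_{n_j}, where
   n_j is so large that f_{n_j} is nearly orthogonal to the preceding partial sum;
   the tail is too short to compensate the j-th term. *)
Lemma gliding_hump (f : nat -> fn R) (delta : nat -> R) :
  (forall n, A2 (f n)) -> (forall n, N (f n) = 1) ->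
  (forall h, A2 h -> (fun n => B h (f n)) @ \oo --> (0 : R)) ->
  delta @ \oo --> (0 : R) ->
  exists2 h, A2 h & forall C, exists n, C * `|delta n| < `|B h (f n)|.
Proof.
move=> Af f1 wk d0.
have Lf n : L2 (f n) := A2_L2 (Af n).
pose q (j : nat) : R := (1 / 4) ^+ j.
have q0 j : 0 < q j by rewrite exprn_gt0//; lra.
have qS j : q j.+1 = q j / 4 by rewrite /q exprS; field.
(* Given the partial sum S and the stage j, choose the next index. Asking for the square q_j^2 makes
   C |delta| negligible against q_j / 3 for large j, whatever C is. *)
have /choice[pk Hpk] : forall Sj : fn R * nat, exists n, A2 Sj.1 ->
    `|B Sj.1 (f n)| <= q Sj.2 / 3 /\ `|delta n| <= q Sj.2 ^+ 2.
  move=> [S j] /=; have [AS|nA] := pselect (A2 S); last by exists 0%N.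
  have [|M1 H1] := (cvgn_epsP _ _).1 (wk S AS) (q j / 3); first by rewrite divr_gt0.
  have [|M2 H2] := (cvgn_epsP _ _).1 d0 (q j ^+ 2); first by rewrite exprn_gt0.
  exists (maxn M1 M2) => _.
  have := H1 _ (leq_maxl M1 M2); have := H2 _ (leq_maxr M1 M2).
  by rewrite !subr0 => /ltW ? /ltW ?.
pose step j S : fn R := fun p => S p + ((q j)%:C)%C * f (pk (S, j)) p.
pose S j : fn R := iteri j step (fun=> 0).
have AS j : A2 (S j).
  elim: j => [|j IH]; first exact: A2_cst.
  by rewrite /S /= -/(S j) /step; apply: A2_lin.
have LS j : L2 (S j) := A2_L2 (AS j).
pose n_ j := pk (S j, j).
have SS j p : S j.+1 p = S j p + ((q j)%:C)%C * f (n_ j) p by [].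
(* Telescoped geometric sum: 4/3 is 1 / (1 - 1/4). *)
have dist n k : N (fun p => S (n + k)%N p - S n p) <= 4 / 3 * (q n - q (n + k)%N).
  elim: k => [|k IH].
    rewrite addn0 subrr mulr0 (@eqD_N _ _ (fun=> 0)); last by move=> p _; rewrite subrr.
    rewrite /N nrmE; under eq_Rintegral do rewrite /n2 !cE expr0n addr0.
    by rewrite Rintegral_cst ?mul0r ?sqrtr0//; exact: measurable_Dp.
  rewrite addnS (@eqD_N _ _ (fun p => (S (n + k)%N p - S n p) +
      ((q (n + k)%N)%:C)%C * f (n_ (n + k)%N) p)); last by move=> p _; rewrite SS; ring.
  apply: le_trans (N_triangle _ _) _; [exact: L2_sub|exact: L2_scale|].
  rewrite N_scale// f1 mulr1 cmodr ?(ltW (q0 _))// qS.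
  by move: IH; lra.
pose eps n := (4 / 3 * q n) ^+ 2.
have eps0 : eps @ \oo --> (0 : R).
  rewrite /eps; under eq_fun do rewrite expr2.
  rewrite -(mulr0 (0 : R)); apply: cvgM; apply: cvgn_scale0; exact: cvg_geometric4.
have Se n m : (n <= m)%N -> nrm (fun p => S m p - S n p) <= eps n.
  move=> /subnKC <-; rewrite -N_sqr /eps lerXn2r ?nnegrE ?N_ge0//.
    by rewrite mulr_ge0 ?(ltW (q0 _))//; lra.
  by apply: le_trans (dist _ _) _; rewrite ler_wpM2l//; have := q0 (n + (m - n))%N; lra.
have [h Ah Hh] := A2_complete AS eps0 Se.
exists h => // C; have Lh := A2_L2 Ah.
have [j Hj] : exists j, C * q j < 1 / 3.
  have [|M HM] := (cvgn_epsP _ _).1 (cvgn_scale0 `|C| cvg_geometric4) (1 / 3); first by lra.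
  exists M; have := HM _ (leqnn M); rewrite subr0 ger0_norm; last first.
    by rewrite mulr_ge0// (ltW (q0 M)).
  by apply: le_lt_trans; rewrite ler_wpM2r ?(ltW (q0 M))// ler_norm.
exists (n_ j).
have [b1 b2] := Hpk (S j, j) (AS j).
(* The remainder after stage j has norm at most (4/3) q_(j+1) = q_j / 3. The ratio 1/4 leaves q_j -
   q_j/3 - q_j/3 = q_j/3 for the pairing of h with the j-th hump. *)
have tail : `|B (fun p => S j.+1 p - h p) (f (n_ j))| <= q j / 3.
  apply: le_trans (CauchySchwarz _ _) _ => //; first exact: L2_sub.
  rewrite f1 mulr1 -(@ler_pXn2r _ 2)// ?nnegrE ?N_ge0//; last first.
    by rewrite divr_ge0// (ltW (q0 j)).
  rewrite N_sqr; apply: le_trans (Hh j.+1) _; rewrite /eps qS.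
  by rewrite (_ : 4 / 3 * (q j / 4) = q j / 3)//; field.
have EB : B (S j.+1) (f (n_ j)) = B (S j) (f (n_ j)) + q j.
  rewrite (@eqD_B _ _ (fun p => S j p + ((q j)%:C)%C * f (n_ j) p) _ (f (n_ j)))//.
  by rewrite B_lin// -/(nrm (f (n_ j))) -N_sqr f1 expr1n mulr1.
have B1 : B (fun p => S j.+1 p - h p) (f (n_ j)) = B (S j.+1) (f (n_ j)) - B h (f (n_ j)).
  by rewrite B_sub.
have low : q j / 3 <= `|B h (f (n_ j))|.
  move: tail b1; rewrite B1 EB /= -/(n_ j) !ler_norml => /andP[t1 t2] /andP[s1 s2].
  by apply: le_trans (ler_norm _); have := q0 j; lra.
apply: lt_le_trans low.
have qj := q0 j.
have [C0|C0] := leP C 0.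
  by apply: (@le_lt_trans _ _ 0); [rewrite mulr_le0_ge0|rewrite divr_gt0].
apply: (@le_lt_trans _ _ (C * q j ^+ 2)).
  by rewrite ler_wpM2l ?(ltW C0)// b2.
by rewrite expr2 mulrA (_ : q j / 3 = 1 / 3 * q j) ?ltr_pM2r//; field.
Qed.

End GlidingHump.

(** * Normalized peak functions at a boundary point *)

Section Peak.
Variable R : realType.
Local Notation mu := (@area R).
Local Notation RR := (measurableTypeR R * measurableTypeR R)%type.
Local Notation mfun A f := (@measurable_fun _ _ RR R A f).
Local Notation Dp := (@Dp R).
Local Notation zc := (@zc R).
Local Notation r2 := (@r2 R).
Local Notation ig A F := (mu.-integrable (A : set RR) (EFin \o (F : RR -> R))).
Implicit Types (f g h : fn R).
Variable zeta : R * R.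
Hypothesis zeta1 : r2 zeta = 1.

Definition dist2 (p : R * R) : R := r2 (p.1 - zeta.1, p.2 - zeta.2).

(** A complex-valued indicator, so that cutting off is multiplication by a bounded symbol; eta is
    the square of the radius. *)
Definition near_zeta (eta : R) : fn R := fun p => ((dist2 p < eta)%R%:R : R[i]).

Lemma mfun_dist2 : mfun setT dist2.
Proof.
rewrite /dist2 /r2 /=; apply: measurable_funD; apply: measurable_funX;
  apply: measurable_funB; solve [exact: measurable_fst|exact: measurable_snd|exact: measurable_cst].
Qed.

Lemma measC_near eta : measC (near_zeta eta).
Proof.
have E p : near_zeta eta p = ((\1_[set q : RR | dist2 q < eta] p)%:C)%C.
  rewrite /near_zeta indicE rmorph_nat; congr ((nat_of_bool _)%:R).
  by apply/idP/idP; rewrite inE.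
have mI : mfun setT \1_[set q : RR | dist2 q < eta].
  by apply: measurable_indic; exact: measurable_sublevel mfun_dist2.
apply: measCP; under eq_fun do rewrite E.
  exact: measurable_funTS mI.
exact: measurable_cst.
Qed.

Lemma cmod_bool (b : bool) : cmod (b%:R : R[i]) <= 1.
Proof. by case: b; rewrite ?cmod1 ?cmod0. Qed.

Lemma n2_bool (b : bool) : n2 (b%:R : R[i]) = if b then 1 else 0.
Proof. by rewrite /n2 !cE expr0n addr0; case: b; rewrite ?expr1n ?expr0n. Qed.

Lemma near_compl eta p : 1 - near_zeta eta p = ((eta <= dist2 p)%R%:R : R[i]).
Proof. by rewrite /near_zeta leNgt; case: (_ < _); rewrite ?subrr ?subr0. Qed.

Lemma measC_far eta : measC (fun p => ((eta <= dist2 p)%R%:R : R[i])).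
Proof.
apply: measC_eqD (measCD (measC_cst 1) (measCM (measC_cst (-1)) (measC_near eta))) => p _.
by rewrite mulN1r near_compl.
Qed.

Definition far (eta : R) f : fn R := fun p => ((eta <= dist2 p)%R%:R : R[i]) * f p.
Definition close (eta : R) f : fn R := fun p => near_zeta eta p * f p.

Lemma L2_far eta f : L2 f -> L2 (far eta f).
Proof. by apply: (@L2_mul _ _ _ 1); [exact: measC_far|move=> p _; exact: cmod_bool]. Qed.
Lemma L2_close eta f : L2 f -> L2 (close eta f).
Proof. by apply: (@L2_mul _ _ _ 1); [exact: measC_near|move=> p _; exact: cmod_bool]. Qed.

Lemma close_far eta f p : f p = close eta f p + far eta f p.
Proof. by rewrite /close /far -near_compl; ring. Qed.

Lemma dist2_gt0 p : Dp p -> 0 < dist2 p.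
Proof.
move=> Dpp; rewrite lt_neqAle r2_ge0 andbT eq_sym; apply/eqP.
rewrite /dist2 /r2 /= => /eqP; rewrite paddr_eq0 ?sqr_ge0// !sqrf_eq0 !subr_eq0.
move=> /andP[/eqP e1 /eqP e2]; move: Dpp; rewrite DpE /rdisc /=.
by rewrite (_ : p = zeta) ?zeta1 ?ltxx//; case: p zeta e1 e2 => a b [c d] /= -> ->.
Qed.

Definition peak n : fn R := fun p => (1 + cconj (zc zeta) * zc p) ^+ n.
Definition peak2 p := 2 + 2 * r2 p - dist2 p.

(** The parallelogram law for 1 and conj(zeta) z, since |1 - conj(zeta) z| = |zeta - z| when |zeta|
    = 1. On the closed disc the modulus thus reaches its maximum 2 only at zeta. *)
Lemma n2_peak1 p : n2 (1 + cconj (zc zeta) * zc p) = peak2 p.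
Proof.
move: zeta1; rewrite /peak2 /dist2 /r2 /n2 !cE /zc /ReC /ImC /= => e.
case: zeta p e => a b [c d] /= e.
have -> : (1 + (a * c - - b * d)) ^+ 2 + (0 + (a * d + - b * c)) ^+ 2 =
   1 + 2 * (a * c + b * d) + (a ^+ 2 + b ^+ 2) * (c ^+ 2 + d ^+ 2) by ring.
have -> : 2 + 2 * (c ^+ 2 + d ^+ 2) - ((c - a) ^+ 2 + (d - b) ^+ 2) =
   2 + (c ^+ 2 + d ^+ 2) + 2 * (a * c + b * d) - (a ^+ 2 + b ^+ 2) by ring.
by rewrite e; ring.
Qed.

Lemma peak2_ge0 p : 0 <= peak2 p. Proof. by rewrite -n2_peak1 n2_ge0. Qed.

Lemma n2_peak n p : n2 (peak n p) = peak2 p ^+ n.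
Proof. by rewrite -n2_peak1 -!cmod_sqr cmodX -!exprM mulnC. Qed.

Lemma A2_peak n : A2 (peak n).
Proof.
apply: eqD_A2 (A2_poly ((1 + (cconj (zc zeta))%:P * 'X) ^+ n)) => p _.
by rewrite /peak !hornerE.
Qed.

Lemma continuous_dist2 : continuous (dist2 : (R * R)%type -> R).
Proof.
move=> p; rewrite /dist2 /r2 /=; under eq_fun do rewrite !expr2.
by apply: cvgD; apply: cvgM; apply: cvgB;
  solve [exact: cvg_fst|exact: cvg_snd|exact: cvg_cst].
Qed.

(** The part of the disc where [peak2] exceeds 4 - eta/2. Where [dist2] is at least eta, [peak2] is
    below 4 - eta, and this gap produces geometric decay. *)
Definition peak_set (eta : R) : set RR := Dp `&` [set p | 2 * (1 - r2 p) + dist2 p < eta / 2].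

Lemma measurable_peak_set eta : measurable (peak_set eta).
Proof.
apply: measurableI; first exact: measurable_Dp.
apply: measurable_sublevel; apply: measurable_funD; last exact: mfun_dist2.
apply: measurable_funM; first exact: measurable_cst.
by apply: measurable_funB; [exact: measurable_cst|exact: measurable_r2].
Qed.

Lemma mu_peak_set eta : 0 < eta <= 1 -> 0 < fine (mu (peak_set eta)).
Proof.
move=> /andP[e0 e1]; have mP := measurable_peak_set eta.
have PD : peak_set eta `<=` Dp by move=> p [].
rewrite fine_gt0//; apply/andP; split; last exact: mu_sub_Dp.
(* At s zeta the defining quantity is 2 (1 - s^2) + (1 - s)^2 = (1 - s) (3 + s) <= 4 (1 - s) =
   eta/4. *)
pose s := 1 - eta / 16.
pose q := (s * zeta.1, s * zeta.2).
have rq : r2 q = s ^+ 2.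
  have -> : r2 q = s ^+ 2 * r2 zeta by rewrite /r2 /q /=; ring.
  by rewrite zeta1 mulr1.
have dq : dist2 q = (1 - s) ^+ 2.
  have -> : dist2 q = (1 - s) ^+ 2 * r2 zeta by rewrite /dist2 /r2 /q /=; ring.
  by rewrite zeta1 mulr1.
apply: (@mu_nbhs_gt0 _ _ q) => //.
have n1 : nbhs (q : (R * R)%type) (r2 @^-1` `]-oo, 1[%classic).
  apply: continuous_r2; apply: near_in_itvNyo.
  by rewrite in_itv /= rq expr_lt1// /s; lra.
have n2 : nbhs (q : (R * R)%type) ((fun p => 2 * (1 - r2 p) + dist2 p) @^-1` `]-oo, (eta / 2)[%classic).
  have c : continuous ((fun p => 2 * (1 - r2 p) + dist2 p) : (R * R)%type -> R).
    move=> p; apply: cvgD; last exact: continuous_dist2.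
    apply: cvgM; first exact: cvg_cst.
    by apply: cvgB; [exact: cvg_cst|exact: continuous_r2].
  apply: c; apply: near_in_itvNyo.
  by rewrite in_itv /= rq dq /s; nra.
by apply: filterS2 n1 n2 => p /=; rewrite !in_itv.
Qed.

Lemma nrm_peak_ge eta n : 0 < eta <= 1 ->
  (4 - eta / 2) ^+ n * fine (mu (peak_set eta)) <= nrm (peak n).
Proof.
move=> /andP[e0 e1]; have mP := measurable_peak_set eta.
have PD : peak_set eta `<=` Dp by move=> p [].
have Lp : L2 (peak n) := A2_L2 (A2_peak n).
apply: le_trans (Rintegral_subset mP PD Lp).
rewrite -Rintegral_cst//; apply: le_Rintegral => //.
- by apply: (@ig_bounded _ _ _ `|(4 - eta / 2) ^+ n|).
- by apply: ig_sub => //; exact: L2_ign2.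
move=> p [_ /=] h; rewrite n2_peak lerXn2r ?nnegrE ?peak2_ge0//; first by lra.
by rewrite /peak2; lra.
Qed.

Lemma nrm_peak_far eta n : 0 < eta <= 1 ->
  nrm (far eta (peak n)) <= (4 - eta) ^+ n * fine (mu Dp).
Proof.
move=> /andP[e0 e1]; have Lp : L2 (peak n) := A2_L2 (A2_peak n).
rewrite nrmE -Rintegral_cst; last exact: measurable_Dp.
apply: le_Rintegral.
- exact: measurable_Dp.
- exact/L2_ign2/L2_far.
- by apply: (@ig_bounded _ _ _ `|(4 - eta) ^+ n|) => //; exact: measurable_Dp.
move=> p Dpp; rewrite /far n2M n2_peak n2_bool; case: (leP eta (dist2 p)) => h; rewrite /= ?mul1r ?mul0r.
  rewrite lerXn2r ?nnegrE ?peak2_ge0//; first by lra.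
  by rewrite /peak2; have : r2 p < 1 by []; lra.
by rewrite exprn_ge0//; lra.
Qed.

Definition npeak n : fn R := fun p => ((N (peak n))^-1%:C)%C * peak n p.

Lemma nrm_peak_gt0 n : 0 < nrm (peak n).
Proof.
have h : 0 < (1 : R) <= 1 by rewrite ltr01 lexx.
apply: lt_le_trans (nrm_peak_ge n h); rewrite mulr_gt0 ?mu_peak_set//.
by rewrite exprn_gt0//; lra.
Qed.

Lemma A2_npeak n : A2 (npeak n).
Proof. by apply: A2_scale; exact: A2_peak. Qed.

Lemma N_npeak n : N (npeak n) = 1.
Proof.
have Lp : L2 (peak n) := A2_L2 (A2_peak n).
rewrite N_scale// cmodr ?invr_ge0 ?N_ge0// mulVf// gt_eqF//.
by rewrite sqrtr_gt0 nrm_peak_gt0.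
Qed.

(** After normalization the far part has squared norm at most a constant times the n-th power of (4
    - eta) / (4 - eta/2) < 1. *)
Lemma N_npeak_far eta : 0 < eta <= 1 ->
  (fun n => N (far eta (npeak n))) @ \oo --> (0 : R).
Proof.
move=> he; have /andP[e0 e1] := he.
have m0 := mu_peak_set he.
pose K := fine (mu Dp) / fine (mu (peak_set eta)).
pose th := (4 - eta) / (4 - eta / 2).
have c : (fun n => K * th ^+ n) @ \oo --> (0 : R).
  apply: cvgn_scale0; apply: cvg_expr; rewrite ger0_norm.
    by rewrite /th ltr_pdivrMr; lra.
  by rewrite /th divr_ge0; lra.
apply: cvgn_le (cvgn_sqrt0 c) _ => n; rewrite subr0 ger0_norm ?N_ge0//.
apply: ler_wsqrtr.
have Lp : L2 (peak n) := A2_L2 (A2_peak n).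
rewrite (@eqD_nrm _ _ (fun p => ((N (peak n))^-1%:C)%C * far eta (peak n) p)); last first.
  by move=> p _; rewrite /far /npeak mulrCA.
rewrite nrm_scale; last exact: L2_far.
rewrite -cmod_sqr cmodr ?invr_ge0 ?N_ge0// exprVn N_sqr mulrC ler_pdivrMr ?nrm_peak_gt0//.
apply: le_trans (nrm_peak_far n he) _.
have -> : (4 - eta) ^+ n * fine (mu Dp) =
    K * th ^+ n * ((4 - eta / 2) ^+ n * fine (mu (peak_set eta))).
  have h1 : (4 - eta / 2) ^+ n != 0 by rewrite expf_neq0// gt_eqF//; lra.
  have h2 : fine (mu (peak_set eta)) != 0 by rewrite gt_eqF.
  rewrite /K /th expr_div_n.
  by field; rewrite h1 h2.
apply: ler_wpM2l; last exact: nrm_peak_ge.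
rewrite mulr_ge0 ?divr_ge0 ?fine_ge0//.
by rewrite exprn_ge0// /th divr_ge0; lra.
Qed.

(** Dominated convergence: zeta lies on the circle, so every point of the disc eventually leaves the
    shrinking neighbourhoods. *)
Lemma nrm_close_cvg h : L2 h ->
  (fun k => nrm (close k.+1%:R^-1 h)) @ \oo --> (0 : R).
Proof.
move=> Lh; have mD : measurable (Dp : set RR) by exact: measurable_Dp.
have H := @dominated_cvg _ _ R mu Dp mD (fun k p => (n2 (close k.+1%:R^-1 h p))%:E)
  (fun=> 0%:E) (fun p => (n2 (h p))%:E).
have {}H : (\int[mu]_(x in Dp) (n2 (close n.+1%:R^-1 h x))%:E @[n --> \oo] -->
    \int[mu]_(x in Dp) 0%:E)%E.
  apply: H => //.
  - move=> k; apply/measurable_EFinP; apply: measC_n2.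
    exact/L2_measC/L2_close.
  - move=> p Dpp; apply: cvg_EFin; first exact: nearW.
    have pc : (fun k => n2 (close k.+1%:R^-1 h p)) @ \oo --> (0 : R).
      apply/cvgn_epsP => e e0.
      have [M HM] := (cvgn_epsP _ _).1 (@cvg_harmonic R) _ (dist2_gt0 Dpp).
      exists M => k /HM; rewrite subr0 => /(le_lt_trans (ler_norm _)) lt.
      have n0 : near_zeta k.+1%:R^-1 p = 0 by rewrite /near_zeta ltNge [X in ~~ X](ltW lt).
      by rewrite /close n0 mul0r /n2 !cE expr0n addr0 subrr normr0.
    exact: pc.
  - exact: L2_ign2.
  move=> k p Dpp; rewrite /= lee_fin ger0_norm ?n2_ge0// /close n2M.
  rewrite ler_piMl ?n2_ge0//; apply: le_trans (n2_le_sqr (cmod_bool _)) _.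
  by rewrite expr1n.
have {}H : (fun k => Rintegral mu Dp (fun p => n2 (close k.+1%:R^-1 h p))) @ \oo --> (0 : R).
  by apply: fine_cvg; rewrite integral0 in H.
by under eq_fun do rewrite nrmE.
Qed.

(** Near zeta the function h has little mass; away from zeta the peaks do. The cutoff is
    self-adjoint for [B] and can be placed on either factor. *)
Lemma npeak_weakly_null h : L2 h -> (fun n => B h (npeak n)) @ \oo --> (0 : R).
Proof.
move=> Lh; apply/cvgn_epsP => e e0.
have [|k Hk] := (cvgn_epsP _ _).1 (cvgn_sqrt0 (nrm_close_cvg Lh)) (e / 2); first by lra.
have := Hk _ (leqnn k); rewrite subr0 ger0_norm ?sqrtr_ge0// -/(N _) => {}Hk.
set eta := k.+1%:R^-1 in Hk.
have he : 0 < eta <= 1 by rewrite invr_gt0 ltr0n invf_le1 ?ler1n.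
have [|M HM] := (cvgn_epsP _ _).1 (cvgn_scale0 (N h) (N_npeak_far he)) (e / 2); first by lra.
exists M => n /HM; rewrite !subr0 ger0_norm ?mulr_ge0 ?N_ge0// => h2.
have Ln : L2 (npeak n) := A2_L2 (A2_npeak n).
have -> : B h (npeak n) = B (close eta h) (npeak n) + B h (far eta (npeak n)).
  rewrite (B_sym h (far _ _)) (_ : B (far eta (npeak n)) h = B (far eta h) (npeak n)).
    rewrite -B_add//; [|exact: L2_close|exact: L2_far].
    by apply: eqD_B => // p _; exact: close_far.
  by apply: eq_Rintegral => p _; rewrite /far /dotc; case: (_ <= _); rewrite !cE; ring.
apply: le_lt_trans (ler_normD _ _) _.
have := CauchySchwarz (L2_close eta Lh) Ln; rewrite N_npeak mulr1 => c1.
have := CauchySchwarz Lh (L2_far eta Ln) => c2.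
by lra.
Qed.

(** The mass of the peaks concentrates at zeta, where psi is small; elsewhere the bound M
    suffices. *)
Lemma N_Mul_npeak (psi : fn R) M : measC psi -> (forall p, Dp p -> cmod (psi p) <= M) ->
  (forall e, 0 < e -> exists2 eta, 0 < eta <= 1 &
     forall p, Dp p -> dist2 p < eta -> cmod (psi p) <= e) ->
  (fun n => N (Mul psi (npeak n))) @ \oo --> (0 : R).
Proof.
move=> mpsi psiM small; apply/cvgn_epsP => e e0.
have M0 : 0 <= M.
  apply: le_trans (cmod_ge0 (psi (0, 0))) (psiM _ _).
  by rewrite DpE /rdisc /r2 /= expr0n addr0.
have [|eta he Heta] := small (e / 2); first by lra.
have [|k HM] := (cvgn_epsP _ _).1 (cvgn_scale0 M (N_npeak_far he)) (e / 2); first by lra.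
exists k => n /HM; rewrite !subr0 ger0_norm ?mulr_ge0 ?N_ge0// => h2.
rewrite ger0_norm ?N_ge0//.
have Ln : L2 (npeak n) := A2_L2 (A2_npeak n).
have mc : measC (close eta psi) by apply: measCM => //; exact: measC_near.
have cb p : Dp p -> cmod (close eta psi p) <= e / 2.
  move=> Dpp; rewrite /close cmodM /near_zeta; case: (ltP (dist2 p) eta) => h /=.
    by rewrite cmod1 mul1r Heta.
  by rewrite cmod0 mul0r; lra.
rewrite (@eqD_N _ _ (fun p => Mul (close eta psi) (npeak n) p + Mul psi (far eta (npeak n)) p)).
  apply: le_lt_trans (N_triangle _ _) _.
  - exact: L2_Mul mc cb _ Ln.
  - by apply: (L2_Mul mpsi psiM); exact: L2_far.
  have := N_Mul mc cb Ln; rewrite N_npeak mulr1 => h3.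
  have := N_Mul mpsi psiM (L2_far eta Ln) M0 => h4.
  have e2 : 0 <= e / 2 by lra.
  by have := h3 e2; lra.
by move=> p _; rewrite /Mul {1}(close_far eta (npeak n)) /close; ring.
Qed.

End Peak.

(** * Lower bounds for the real part of the symbol and coercivity *)

Section Coercive.
Variables (R : realType) (phi : fn R).
Local Notation mu := (@area R).
Local Notation RR := (measurableTypeR R * measurableTypeR R)%type.
Local Notation Dp := (@Dp R).
Local Notation cDp := (@cDp R).
Local Notation r2 := (@r2 R).
Local Notation ann := (@ann R).
Implicit Types (f g h : fn R).
Hypotheses (cphi : contCD phi) (mphi : measC phi).
Hypothesis hphi : forall p, Dp p -> `|ImC (phi p)| ^+ 2 <= ReC (phi p).

Lemma compact_cDp : compact (cDp : set (R * R)%type).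
Proof.
apply: (@subclosed_compact _ _
  (([set` `[-1, 1]] : set R) `*` ([set` `[-1, 1]] : set R))).
- have -> : cDp = r2 @^-1` [set x | x <= 1] by [].
  by apply: (continuous_closedP _).1; [exact: continuous_r2|exact: closed_le].
- by apply: compact_setX; exact: segment_compact.
move=> [x y]; rewrite /cDp /= !in_itv /= => h.
by split; apply/andP; split; nra.
Qed.

Lemma Dp_cDp p : Dp p -> cDp p. Proof. by move=> h; exact: ltW. Qed.

Lemma cphi_within p : cDp p ->
  (fun q => (ReC (phi q), ImC (phi q))) @ within cDp (nbhs p) --> (ReC (phi p), ImC (phi p)).
Proof. exact: (subspace_continuousP _ _).1. Qed.

Lemma Re_phi_within p : cDp p ->
  (fun q => ReC (phi q)) @ within cDp (nbhs p) --> ReC (phi p).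
Proof.
move=> cp; apply: (@cvg_comp _ _ _ (fun q => (ReC (phi q), ImC (phi q))) fst _ _ _
  (cphi_within cp)); exact: cvg_fst.
Qed.

Lemma Im_phi_within p : cDp p ->
  (fun q => ImC (phi q)) @ within cDp (nbhs p) --> ImC (phi p).
Proof.
move=> cp; apply: (@cvg_comp _ _ _ (fun q => (ReC (phi q), ImC (phi q))) snd _ _ _
  (cphi_within cp)); exact: cvg_snd.
Qed.

Lemma phi_continuous_eps zeta e : cDp zeta -> 0 < e -> exists2 eta, 0 < eta <= 1 &
  forall p, cDp p -> dist2 zeta p < eta -> cmod (phi p - phi zeta) <= e.
Proof.
move=> cz e0; have /cvg_ballP/(_ (e / 2)) := cphi_within cz.
have e2 : 0 < e / 2 by lra.
move=> /(_ e2) /nbhs_ballP[d /= d0 Hd].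
(* [dist2] is a squared distance, hence d^2; the cap 1 is the range in which the peak estimates
   hold. *)
pose eta := Num.min 1 (d ^+ 2).
exists eta; first by rewrite /eta lt_min ltr01 exprn_gt0//= ge_min lexx.
move=> p cp; rewrite /eta lt_min => /andP[_]; rewrite /dist2 /=.
rewrite /r2 /= => h.
have [|h1 h2] := Hd p _ cp.
  split; rewrite /ball /= distrC -sqrtr_sqr -[ltRHS]ger0_norm ?(ltW d0)// -sqrtr_sqr;
    rewrite ltr_sqrt ?exprn_gt0//; apply: le_lt_trans h.
    by rewrite lerDl sqr_ge0.
  by rewrite lerDr sqr_ge0.
apply: le_trans (cmod_le_ReIm _) _; rewrite !cE.
move: h1 h2; rewrite /ball /= => h1 h2.
by rewrite distrC [X in _ + X]distrC; lra.
Qed.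

Lemma phi_bounded : exists2 M, 0 <= M & forall p, Dp p -> cmod (phi p) <= M.
Proof.
have c : {within cDp, continuous (fun q => n2 (phi q))}.
  apply/subspace_continuousP => p cp.
  have h1 := Re_phi_within cp; have h2 := Im_phi_within cp.
  rewrite /n2; under eq_fun do rewrite !expr2.
  by apply: cvgD; apply: cvgM.
have [|q _ Hq] := compact_EVT_max _ compact_cDp c.
  by exists (0, 0); rewrite /cDp /= expr0n addr0 ler01.
exists (Num.sqrt (n2 (phi q))); first exact: sqrtr_ge0.
move=> p Dpp; rewrite -/(cmod (phi p)); apply: ler_wsqrtr.
by apply: Hq; rewrite inE; exact: Dp_cDp.
Qed.

(** The inequality is given on the open disc only and is carried to the circle along a radius: Re
    phi <= 0 at zeta forces Re phi = 0 there, and then Im phi = 0. *)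
Lemma Re_phi_gt0 zeta : r2 zeta = 1 -> phi zeta <> 0 -> 0 < ReC (phi zeta).
Proof.
move=> z1 nz; rewrite ltNge; apply/negP => a0; apply: nz.
have cz : cDp zeta by rewrite /cDp /= -/(r2 zeta) z1.
set a := ReC (phi zeta); set b := ImC (phi zeta).
(* At a nearby radial point phi = x + i y with 0 <= x <= e, hence y^2 <= e, and b^2 <= 2 y^2 + 2 (b
   - y)^2 <= 2 e + 2 e^2 <= 4 e. *)
have key e : 0 < e <= 1 -> - e <= a /\ b ^+ 2 <= 4 * e.
  move=> /andP[e0 e1].
  have [eta /andP[h0 h1] Heta] := phi_continuous_eps cz e0.
  pose s := 1 - eta / 2; pose q := (s * zeta.1, s * zeta.2).
  have rq : r2 q = s ^+ 2.
    have -> : r2 q = s ^+ 2 * r2 zeta by rewrite /r2 /q /=; ring.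
    by rewrite z1 mulr1.
  have dq : dist2 zeta q = (1 - s) ^+ 2.
    have -> : dist2 zeta q = (1 - s) ^+ 2 * r2 zeta by rewrite /dist2 /r2 /q /=; ring.
    by rewrite z1 mulr1.
  have Dq : Dp q by rewrite DpE /rdisc /= rq expr_lt1// /s; lra.
  have hq : cmod (phi q - phi zeta) <= e.
    by apply: Heta; [exact: Dp_cDp|rewrite dq /s; nra].
  have hR := le_trans (normr_ReC _) hq; have hI := le_trans (normr_ImC _) hq.
  move: hR hI; rewrite !cE !ler_norml -/a -/b => /andP[r1 r2'] /andP[i1 i2].
  have := hphi Dq; rewrite real_normK ?num_real//.
  move: r1 r2' i1 i2; set x := ReC (phi q); set y := ImC (phi q) => r1 r2' i1 i2 yx.
  have x0 : 0 <= x := le_trans (sqr_ge0 y) yx.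
  split; first by lra.
  have xe : x <= e by move: a0; rewrite -/a; lra.
  have ye : (b - y) ^+ 2 <= e ^+ 2 by nra.
  have := sqr_ge0 (b - 2 * y); nra.
have ae : a = 0.
  apply/eqP; rewrite eq_le a0 /= leNgt; apply/negP => an.
  have [] := key (Num.min 1 (- a / 2)).
    by rewrite lt_min ltr01 ge_min lexx /= andbT; lra.
  have : Num.min 1 (- a / 2) <= - a / 2 by rewrite ge_min lexx orbT.
  by set x := Num.min _ _; lra.
have be : b ^+ 2 <= 0.
  rewrite leNgt; apply/negP => bn.
  have [] := key (Num.min 1 (b ^+ 2 / 8)).
    by rewrite lt_min ltr01 ge_min lexx /= andbT; lra.
  have : Num.min 1 (b ^+ 2 / 8) <= b ^+ 2 / 8 by rewrite ge_min lexx orbT.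
  by set x := Num.min _ _; lra.
by apply: n2_le0; rewrite /n2 -/a -/b ae expr0n add0r.
Qed.

Lemma Re_phi_ge0 p : Dp p -> 0 <= ReC (phi p).
Proof. by move=> Dpp; apply: le_trans (hphi Dpp); exact: exprn_ge0. Qed.

Hypothesis nz : forall zeta, r2 zeta = 1 -> phi zeta <> 0.

(** Re phi + 1 - |z|^2 is positive on the whole closed disc: inside because of the added term, on
    the circle by [Re_phi_gt0]. Its minimum m is positive by compactness, and near the circle the
    added term is too small to account for it. *)
Lemma Re_phi_annulus : exists c m : R, [/\ 0 < c < 1, 0 < m &
  forall p, ann c 1 p -> m <= ReC (phi p)].
Proof.
have cc : {within cDp, continuous (fun q => ReC (phi q) + (1 - r2 q))}.
  apply/subspace_continuousP => p cp.
  have h1 := Re_phi_within cp.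
  apply: cvgD => //; apply: cvgB; first exact: cvg_cst.
  by apply: cvg_within_filter; exact: continuous_r2.
have [|q /set_mem cq Hq] := compact_EVT_min _ compact_cDp cc.
  by exists (0, 0); rewrite /cDp /= expr0n addr0 ler01.
set m := ReC (phi q) + (1 - r2 q) in Hq.
have m0 : 0 < m.
  move: cq; rewrite /cDp /= -/(r2 q) le_eqVlt => /orP[/eqP q1|q1].
    by rewrite /m q1 subrr addr0; apply: Re_phi_gt0 => //; exact: nz.
  by have := Re_phi_ge0 q1; rewrite /m; lra.
(* Where |z|^2 >= 1 - m/2 the added term is at most m/2; the value 1/2 keeps the inner bound
   positive when m is large. *)
exists (Num.max (1 / 2) (1 - m / 2)), (m / 2); split.
- by rewrite lt_max gt_max; apply/andP; split; [apply/orP; left|apply/andP; split]; lra.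
- by lra.
move=> p /andP[]; rewrite ge_max => /andP[_ h1] h2.
have := Hq p; rewrite inE => /(_ (Dp_cDp h2)); lra.
Qed.

(** Against f in A^2 the projection drops out and [B] becomes the integral of Re phi |f|^2. As Re
    phi >= 0, this may be restricted to the annulus, where Re phi >= m; [annulus_bound] then costs
    the factor K. *)
Lemma Toeplitz_coercive : exists2 k, 0 < k & forall f, A2 f -> k * nrm f <= B (Toeplitz phi f) f.
Proof.
have [M M0 phiM] := phi_bounded.
have [c [m [c01 m0 Hm]]] := Re_phi_annulus.
have [K K0 HK] := annulus_bound c01.
exists (m / K); first by rewrite divr_gt0.
move=> f Af; have Lf := A2_L2 Af; rewrite (B_Toeplitz mphi phiM)//.
have mA := @measurable_ann R c 1.
have AD : ann c 1 `<=` Dp by exact: ann_Dp.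
have E p : dotc (Mul phi f p) (f p) = ReC (phi p) * n2 (f p).
  by rewrite /dotc /Mul /n2 !cE; ring.
have igM := L2_igdot (L2_Mul mphi phiM Lf) Lf.
apply: (@le_trans _ _ (m * Rintegral mu (ann c 1) (fun p => n2 (f p)))).
  by rewrite -mulrA ler_pM2l// mulrC ler_pdivrMr// mulrC HK.
rewrite -RintegralZl//; last by apply: ig_sub => //; exact: L2_ign2.
apply: (@le_trans _ _ (Rintegral mu (ann c 1) (fun p => dotc (Mul phi f p) (f p)))).
  apply: le_Rintegral => //.
  - by apply: igZ => //; apply: ig_sub => //; exact: L2_ign2.
  - exact: ig_sub.
  by move=> p Ap; rewrite E ler_wpM2r ?n2_ge0// Hm.
rewrite /B /Rintegral; apply: fine_le.
- by apply: integrable_fin_num => //; apply: ig_sub.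
- by apply: integrable_fin_num => //; exact: measurable_Dp.
apply: ge0_subset_integral => //.
- exact: measurable_Dp.
- by case/integrableP: igM.
- by move=> p Dpp; rewrite lee_fin E mulr_ge0 ?n2_ge0// Re_phi_ge0.
Qed.

End Coercive.

(** * Inversion of coercive Toeplitz operators *)

Section CoerciveInverse.
Variables (R : realType) (phi : fn R) (M k : R).
Local Notation Dp := (@Dp R).
Local Notation T := (Toeplitz phi).
Hypotheses (mphi : measC phi) (phiM : forall p, Dp p -> cmod (phi p) <= M) (M0 : 0 <= M).
Hypotheses (k0 : 0 < k) (Tk : forall f, A2 f -> k * nrm f <= B (T f) f).
Implicit Types (f g h : fn R).

Let AT f : A2 f -> A2 (T f) := A2_Toeplitz mphi phiM (f := f).

Lemma coercive_N_le f : A2 f -> k * N f <= N (T f).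
Proof.
move=> Af; have h : k * N f * N f <= N (T f) * N f.
  rewrite -mulrA -expr2 N_sqr; apply: le_trans (Tk Af) _.
  apply: le_trans (ler_norm _) _.
  by apply: CauchySchwarz; apply: A2_L2 => //; exact: AT.
have := N_ge0 f; rewrite le_eqVlt => /orP[/eqP <-|f0].
  by rewrite mulr0 N_ge0.
by rewrite ler_pM2r in h.
Qed.

Lemma Toeplitz_sub f g : A2 f -> A2 g -> eqD (T (fun p => f p - g p)) (fun p => T f p - T g p).
Proof.
move=> Af Ag p Dpp; rewrite -mulN1r -(Toeplitz_lin mphi phiM (-1) Af Ag Dpp).
apply: (Toeplitz_eqD mphi phiM) => //; [exact: A2_sub|exact: A2_lin|].
by move=> q _; rewrite mulN1r.
Qed.

Lemma coercive_Toeplitz_inj f g : A2 f -> A2 g -> eqD (T f) (T g) -> eqD f g.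
Proof.
move=> Af Ag fg p Dpp; have Ad := A2_sub Af Ag.
have := coercive_N_le Ad; rewrite (@eqD_N _ (T _) (fun=> 0)); last first.
  by move=> q Dq; rewrite Toeplitz_sub// fg// subrr.
rewrite {2}/N nrmE; under eq_Rintegral do rewrite /n2 !cE expr0n addr0.
rewrite Rintegral_cst; last exact: measurable_Dp.
rewrite mul0r sqrtr0 pmulr_rle0// => h.
have : N (fun p => f p - g p) = 0 by apply/eqP; rewrite eq_le h N_ge0.
by move=> /(A2_N0 Ad)/(_ p Dpp)/eqP; rewrite subr_eq0 => /eqP.
Qed.

(* Richardson iteration: for small t > 0 the map f - t T f is a contraction. *)
Lemma coercive_Toeplitz_surj h : A2 h -> exists2 g, A2 g & eqD (T g) h.
Proof.
move=> Ah; have Lh := A2_L2 Ah.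
have M0' := M0; have k0' := k0.
(* L bounds the norm of T, and adding k ensures 0 < k <= L. The step t minimizes 1 - 2 t k + t^2
   L^2, and [q2] is the minimum. *)
pose L := M + k; have L0 : 0 < L by rewrite /L; lra.
pose t := k / L ^+ 2; have t0 : 0 < t by rewrite divr_gt0 ?exprn_gt0.
pose q2 := 1 - k ^+ 2 / L ^+ 2.
have q20 : 0 <= q2.
  by rewrite subr_ge0 ler_pdivrMr ?exprn_gt0// mul1r lerXn2r ?nnegrE ?(ltW k0) ?(ltW L0)// /L; lra.
have q21 : q2 < 1 by rewrite gtrBl divr_gt0 ?exprn_gt0.
pose q := Num.sqrt q2.
have q0 : 0 <= q := sqrtr_ge0 _.
have q1 : q < 1 by rewrite -sqrtr1 ltr_sqrt.
have contr f : A2 f -> N (fun p => f p + ((- t)%:C)%C * T f p) <= q * N f.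
  move=> Af; have Lf := A2_L2 Af; have LT := A2_L2 (AT Af).
  rewrite -sqrtrM//; apply: ler_wsqrtr; rewrite nrm_lin// sqrrN.
  have h1 := Tk Af.
  have h2 : nrm (T f) <= L ^+ 2 * nrm f.
    rewrite -!N_sqr -exprMn lerXn2r ?nnegrE ?N_ge0 ?mulr_ge0 ?(ltW L0) ?N_ge0//.
    apply: le_trans (N_Toeplitz mphi phiM Af M0) _.
    by rewrite ler_wpM2r ?N_ge0// /L; lra.
  have h3 : 2 * t * (k * nrm f) <= 2 * t * B f (T f).
    by rewrite (B_sym f); apply: ler_wpM2l => //; lra.
  have h4 : t ^+ 2 * nrm (T f) <= t ^+ 2 * (L ^+ 2 * nrm f).
    by apply: ler_wpM2l => //; exact: sqr_ge0.
  have -> : q2 * nrm f = nrm f - 2 * t * (k * nrm f) + t ^+ 2 * (L ^+ 2 * nrm f).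
    by rewrite /q2 /t; field; rewrite gt_eqF.
  by lra.
pose step g : fn R := fun p => g p + ((- t)%:C)%C * (T g p - h p).
pose u n := iter n step (fun=> 0).
have Au n : A2 (u n).
  elim: n => [|n IH]; first exact: A2_cst.
  by rewrite /u /= -/(u n); apply: A2_lin => //; apply: A2_sub => //; exact: AT.
have Lu n : L2 (u n) := A2_L2 (Au n).
pose d n : fn R := fun p => u n.+1 p - u n p.
have Ad n : A2 (d n) by exact: A2_sub.
have dE n p : d n p = ((- t)%:C)%C * (T (u n) p - h p).
  by rewrite /d /u /= -/(u n) /step; ring.
(* The increment is -t times the residual T u_n - h, so h cancels between successive increments and
   each is the image of the previous one under the contraction. *)
have dS n : eqD (d n.+1) (fun p => d n p + ((- t)%:C)%C * T (d n) p).
  move=> p Dpp; rewrite [LHS]dE [in RHS]dE (Toeplitz_sub (Au n.+1) (Au n) Dpp); ring.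
have Nd n : N (d n) <= q ^+ n * N (d 0%N).
  elim: n => [|n IH]; first by rewrite expr0 mul1r.
  rewrite (eqD_N (dS n)); apply: le_trans (contr _ (Ad n)) _.
  by rewrite exprS -mulrA ler_wpM2l.
pose K := N (d 0%N) / (1 - q).
have K0 : 0 <= K by rewrite divr_ge0 ?N_ge0// subr_ge0 ltW.
have dist n j : N (fun p => u (n + j)%N p - u n p) <= K * (q ^+ n - q ^+ (n + j)).
  elim: j => [|j IH].
    rewrite addn0 subrr mulr0 (@eqD_N _ _ (fun=> 0)); last by move=> p _; rewrite subrr.
    rewrite /N nrmE; under eq_Rintegral do rewrite /n2 !cE expr0n addr0.
    by rewrite Rintegral_cst ?mul0r ?sqrtr0//; exact: measurable_Dp.
  rewrite addnS.
  rewrite (@eqD_N _ _ (fun p => d (n + j)%N p + (u (n + j)%N p - u n p))); last first.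
    by move=> p _; rewrite /d; ring.
  apply: le_trans (N_triangle _ _) _; [exact: A2_L2|exact: L2_sub|].
  have := Nd (n + j)%N; rewrite exprS.
  have -> : N (d 0%N) = K * (1 - q) by rewrite /K divfK// gt_eqF// subr_gt0.
  by move: IH; set x := q ^+ n; set y := q ^+ (n + j); lra.
pose eps n := (K * q ^+ n) ^+ 2.
have qc : (fun n => q ^+ n) @ \oo --> (0 : R) by apply: cvg_expr; rewrite ger0_norm.
have eps0 : eps @ \oo --> (0 : R).
  rewrite /eps; under eq_fun do rewrite expr2.
  by rewrite -(mulr0 (0 : R)); apply: cvgM; apply: cvgn_scale0.
have ue n m : (n <= m)%N -> nrm (fun p => u m p - u n p) <= eps n.
  move=> /subnKC <-; rewrite -N_sqr /eps lerXn2r ?nnegrE ?N_ge0//.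
    by rewrite mulr_ge0 ?exprn_ge0.
  by apply: le_trans (dist _ _) _; rewrite ler_wpM2l// gerBl exprn_ge0.
have [g Ag Hg] := A2_complete Au eps0 ue.
exists g => //; have ATg := AT Ag.
have Lg := A2_L2 Ag.
(* T g - h = T (g - u_n) + (T u_n - h), and the second summand is -d_n / t. *)
have ub n : N (fun p => T g p - h p) <= (M * K + N (d 0%N) / t) * q ^+ n.
  have Adn := Ad n; have Ldn := A2_L2 Adn.
  rewrite (@eqD_N _ _ (fun p => T (fun p => g p - u n p) p +
      ((- t^-1)%:C)%C * d n p)); last first.
    move=> p Dpp; rewrite Toeplitz_sub// dE mulrA -rmorphM /= mulrNN mulVf ?gt_eqF//.
    by rewrite mul1r; ring.
  have Agu : A2 (fun p => g p - u n p) by exact: A2_sub.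
  apply: le_trans (N_triangle _ _) _; [exact/A2_L2/AT|exact: L2_scale|].
  rewrite N_scale// rmorphN cmodN cmodr ?invr_ge0 ?(ltW t0)//.
  have h1 : N (T (fun p => g p - u n p)) <= M * (K * q ^+ n).
    apply: le_trans (N_Toeplitz mphi phiM Agu M0) _; rewrite ler_wpM2l// N_sub_sym.
    have Kq : 0 <= K * q ^+ n by apply: mulr_ge0 => //; exact: exprn_ge0.
    rewrite -(@ler_pXn2r _ 2)// ?nnegrE ?N_ge0//.
    by rewrite N_sqr; exact: Hg.
  have h2 : t^-1 * N (d n) <= t^-1 * (q ^+ n * N (d 0%N)).
    by apply: ler_wpM2l => //; rewrite invr_ge0 ltW.
  have -> : (M * K + N (d 0%N) / t) * q ^+ n = M * (K * q ^+ n) + t^-1 * (q ^+ n * N (d 0%N)).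
    by ring.
  exact: lerD.
have z : N (fun p => T g p - h p) = 0.
  apply/eqP; rewrite eq_le N_ge0 andbT.
  exact: (cvgn_lb (M := 0) (cvgn_scale0 (M * K + N (d 0%N) / t) qc) (fun n _ => ub n)).
move=> p Dpp; have := A2_N0 (A2_sub ATg Ah) z Dpp.
by move=> /eqP; rewrite subr_eq0 => /eqP.
Qed.

Lemma coercive_Toeplitz_invertible : invertible_A2 T.
Proof.
(* Outside A^2 the inverse takes an arbitrary value. *)
have /choice[S HS] : forall h, exists g, A2 h -> A2 g /\ eqD (T g) h.
  move=> h; have [Ah|nA] := pselect (A2 h); last by exists h.
  by have [g Ag Eg] := coercive_Toeplitz_surj Ah; exists g.
have AS h : A2 h -> A2 (S h) by move=> /HS[].
have TS h : A2 h -> eqD (T (S h)) h by move=> /HS[].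
exists S; split; last first.
  move=> f Af; split; last exact: TS.
  by apply: coercive_Toeplitz_inj => //; [exact/AS/AT|exact/TS/AT].
split; first exact: AS.
split.
  move=> f g Af Ag fg; apply: coercive_Toeplitz_inj; [exact: AS..|].
  by move=> p Dpp; rewrite !TS// fg.
split.
  move=> f g c Af Ag; have Al := A2_lin c Af Ag.
  apply: coercive_Toeplitz_inj; [exact: AS|by apply: A2_lin; exact: AS|].
  move=> p Dpp; rewrite (Toeplitz_lin mphi phiM c (AS _ Af) (AS _ Ag) Dpp).
  by rewrite !TS.
(* The constant is squared because boundedness is expressed with squared norms. *)
exists (k ^- 2) => f Af; rewrite !sqnormE mulrCA ler_wpM2l//.
  by rewrite invr_ge0 ltW// pi_gt0.
rewrite mulrC ler_pdivlMr ?exprn_gt0// -!N_sqr -exprMn mulrC.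
rewrite lerXn2r ?nnegrE ?mulr_ge0 ?N_ge0 ?(ltW k0)//.
by apply: le_trans (coercive_N_le (AS _ Af)) _; rewrite (eqD_N (TS _ Af)).
Qed.

End CoerciveInverse.

(** * The Fredholm property excludes boundary zeros; invertible operators are Fredholm *)

Section NonVanishing.
Variables (R : realType) (phi : fn R).
Local Notation Dp := (@Dp R).
Local Notation T := (Toeplitz phi).
Implicit Types (f g h : fn R).

Lemma cvgn_sum0 (I : Type) (s : seq I) (F : I -> nat -> R) :
  (forall i, F i @ \oo --> (0 : R)) -> (fun n => \sum_(i <- s) F i n) @ \oo --> (0 : R).
Proof.
move=> HF; elim: s => [|i s IH].
  by under eq_fun do rewrite big_nil; exact: cvg_cst.
under eq_fun do rewrite big_cons.
by have := cvgD (HF i) IH; rewrite addr0; exact.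
Qed.

(** [B] is only real-bilinear, so a complex scalar splits into its action on f and on i f. *)
Lemma B_cscale_le f h (c : R[i]) : L2 f -> L2 h ->
  `|B (fun p => c * f p) h| <= cmod c * (`|B f h| + `|B (fun p => 'i%C * f p) h|).
Proof.
move=> Lf Lh; have Li : L2 (fun p => 'i%C * f p) by exact: L2_scale.
have -> : B (fun p => c * f p) h = ReC c * B f h + ImC c * B (fun p => 'i%C * f p) h.
  rewrite /B -!RintegralZl; [|exact: measurable_Dp|exact: L2_igdot|exact: measurable_Dp|exact: L2_igdot].
  rewrite -RintegralD; [|exact: measurable_Dp|apply: igZ; [exact: L2_igdot|exact: measurable_Dp]..].
  by apply: eq_Rintegral => p _; rewrite /dotc !cE; ring.
apply: le_trans (ler_normD _ _) _; rewrite !normrM mulrDr.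
by apply: lerD; apply: ler_wpM2r => //; [exact: normr_ReC|exact: normr_ImC].
Qed.

Lemma B_sum_le (I : Type) (s : seq I) (c : I -> R[i]) (e : I -> fn R) h :
  (forall i, L2 (e i)) -> L2 h ->
  L2 (fun p => \sum_(i <- s) c i * e i p) /\
  `|B (fun p => \sum_(i <- s) c i * e i p) h| <=
    \sum_(i <- s) cmod (c i) * (`|B (e i) h| + `|B (fun p => 'i%C * e i p) h|).
Proof.
move=> Le Lh; elim: s => [|i s [LI IH]].
  rewrite big_nil; under eq_fun do rewrite big_nil; split; first exact: L2_cst.
  rewrite /B; under eq_Rintegral do rewrite ?big_nil /dotc !cE !mul0r addr0.
  by rewrite Rintegral_cst ?mul0r ?normr0//; exact: measurable_Dp.
rewrite big_cons; under eq_fun do rewrite big_cons.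
have Li : L2 (fun p => c i * e i p) by exact: L2_scale.
split; first exact: L2_add.
rewrite B_add//; apply: le_trans (ler_normD _ _) _.
by apply: lerD => //; exact: B_cscale_le.
Qed.

(** Writing an arbitrary h as T g + sum c_i e_i bounds its pairings with the peaks at a boundary
    zero by C delta_n, which contradicts the h produced by [gliding_hump]. *)
Lemma fredholm_nonvanishing M : measC phi -> (forall p, Dp p -> cmod (phi p) <= M) ->
  contCD phi -> fredholm_A2 T -> forall zeta, r2 zeta = 1 -> phi zeta <> 0.
Proof.
move=> mphi phiM cphi [_ [k [e [Ae He]]]] zeta z1 pz.
have Le i : L2 (e i) := A2_L2 (Ae i).
pose f := npeak zeta.
have Af n : A2 (f n) := A2_npeak zeta n.
have Lf n : L2 (f n) := A2_L2 (Af n).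
pose psi : fn R := fun p => cconj (phi p).
have mpsi : measC psi by exact: measC_conj.
have cJ (x : R[i]) : cmod (cconj x) = cmod x by rewrite /cmod !cE sqrrN.
have psiM p : Dp p -> cmod (psi p) <= M by move=> Dpp; rewrite cJ phiM.
have small eps : 0 < eps -> exists2 eta, 0 < eta <= 1 &
    forall p, Dp p -> dist2 zeta p < eta -> cmod (psi p) <= eps.
  move=> e0; have cz : cDp zeta by rewrite /cDp /= -/(r2 zeta) z1.
  have [eta he Heta] := phi_continuous_eps cphi cz e0.
  exists eta => // p Dpp dp; rewrite cJ.
  by have := Heta p (Dp_cDp Dpp) dp; rewrite pz subr0.
have c1 := N_Mul_npeak z1 mpsi psiM small.
pose w i n := `|B (e i) (f n)| + `|B (fun p => 'i%C * e i p) (f n)|.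
have wc i : w i @ \oo --> (0 : R).
  rewrite -(addr0 (0 : R)); apply: cvgD; rewrite -(normr0 R); apply: cvg_norm.
    exact: npeak_weakly_null.
  by apply: npeak_weakly_null => //; exact: L2_scale.
(* The first term controls pairings with the range of T, the sum those with the complement; neither
   involves h, which enters only through C. *)
pose delta n := N (Mul psi (f n)) + \sum_(i < k) w i n.
have dc : delta @ \oo --> (0 : R).
  by have := cvgD c1 (cvgn_sum0 (index_enum _) wc); rewrite addr0; exact.
have [h Ah Hh] := gliding_hump Af (N_npeak z1)
  (fun h Ah => npeak_weakly_null z1 (A2_L2 Ah)) dc.
have [g [c [Ag Eh]]] := He h Ah.
have Lg := A2_L2 Ag.
pose C := N g + \sum_(i < k) cmod (c i).
have [n] := Hh C; apply/negP; rewrite -leNgt.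
have AT := A2_Toeplitz mphi phiM Ag.
have [LS BS] := B_sum_le (index_enum _) c Le (Lf n).
rewrite (eqD_B Eh (fun p _ => erefl (f n p))) B_add//; last exact: A2_L2.
rewrite (B_Toeplitz mphi phiM)//.
(* The adjoint of multiplication by phi puts conj(phi) on the peak, so that no information on g
   beyond its norm is required. *)
have -> : B (Mul phi g) (f n) = B g (Mul psi (f n)).
  by apply: eq_Rintegral => p _; rewrite /dotc /Mul /psi !cE; ring.
have s0 : 0 <= \sum_(i < k) cmod (c i) by apply: sumr_ge0 => i _; exact: cmod_ge0.
have w0 : 0 <= \sum_(i < k) w i n by apply: sumr_ge0 => i _; exact: addr_ge0.
have N0 := N_ge0 (Mul psi (f n)).
apply: le_trans (ler_normD _ _) _.
rewrite [`|delta n|]ger0_norm; last by rewrite addr_ge0.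
rewrite /C /delta mulrDl; apply: lerD.
  apply: le_trans (CauchySchwarz Lg (L2_Mul mpsi psiM (Lf n))) _.
  by rewrite ler_wpM2l ?N_ge0// lerDl.
apply: le_trans BS _; rewrite mulr_suml; apply: ler_sum => i _.
apply: ler_wpM2l; first exact: cmod_ge0.
apply: (@le_trans _ _ (\sum_(i < k) w i n)); last by rewrite lerDr.
rewrite (bigD1 i)//= lerDl; apply: sumr_ge0 => j _; exact: addr_ge0.
Qed.

Lemma invertible_fredholm (S0 : fn R -> fn R) : invertible_A2 S0 -> fredholm_A2 S0.
Proof.
move=> [S [[AS [Seq [Slin _]]] HS]].
have A0 : A2 (fun=> 0 : R[i]) := A2_cst 0.
(* Linearity is given for combinations f + c g, so S 0 = 0 is read off from 0 = 0 + (-1) 0. *)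
have Sz : eqD (S (fun=> 0)) (fun=> 0).
  move=> p Dpp; have E := Slin _ _ (-1) A0 A0 p Dpp.
  have E2 : eqD (S (fun=> 0)) (S (fun p => 0 + -1 * 0)).
    by apply: Seq => [//||q _]; [exact: A2_lin|rewrite mulr0 addr0].
  by rewrite (E2 p Dpp) E mulN1r subrr.
(* With empty families the two conditions say that the operator is injective and surjective. *)
split; exists 0%N, (fun=> fun=> 0); split.
- by case.
- move=> f Af T0; exists (fun=> 0) => p Dpp; rewrite big_ord0.
  have A1 : A2 (S0 f) by apply: eqD_A2 A0 => q Dq; rewrite T0.
  by rewrite -((HS f Af).1 p Dpp) (Seq _ _ A1 A0 T0 p Dpp) Sz.
- by case.
move=> h Ah; exists (S h), (fun=> 0); split; first exact: AS.
by move=> p Dpp; rewrite big_ord0 addr0 ((HS h Ah).2 p Dpp).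
Qed.

End NonVanishing.

Theorem theorem5p6 (R : realType) (phi : fn R) :
  contCD phi -> AQ phi ->
  (forall p, Dp p -> `|ImC (phi p)| ^+ 2 <= ReC (phi p)) ->
  (invertible_A2 (Toeplitz phi) <-> fredholm_A2 (Toeplitz phi)).
Proof.
move=> cphi [[mphi _] _] hphi; split; first exact: invertible_fredholm.
move=> fr; have [M M0 phiM] := phi_bounded cphi.
have nz := fredholm_nonvanishing mphi phiM cphi fr.
have [k k0 Tk] := Toeplitz_coercive cphi mphi hphi nz.
exact: coercive_Toeplitz_invertible mphi phiM M0 k0 Tk.
Qed.
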